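(* Let $\mathcal{GC}(\widetilde B,\mathcal P)$ be a generalized cluster structure of geometric type with $N$ cluster variables, where $\widetilde B$ has skew-symmetrizable principal part and is of full rank, and suppose that $$\operatorname{rank}\widetilde B(i)=d_i-1$$ for any nontrivial string in $\mathcal P$. Let $\widehat{\mathbb A}$ be a ground ring with $\mathbb A\subseteq\widehat{\mathbb A}\subseteq\bar{\mathbb A}$. Then the upper bounds $\overline{\mathcal A}(\mathcal N)$ do not depend on the choice of the nerve $\mathcal N$, and hence coincide with the generalized upper cluster algebra $\overline{\mathcal A}(\widetilde B,\mathcal P)$ over $\widehat{\mathbb A}$.
   Context: **Generalized cluster structures.** Let $\widetilde B=(b_{ij})$ be an $N\times(N+M)$ integer matrix whose principal part (leading $N\times N$ submatrix) is skew-symmetrizable. Let $\mathcal F$ be the field of rational functions in $N+M$ independent variables with rational coefficients; $M$ distinguished variables $x_{N+1},\dots,x_{N+M}$ are called stable. A stable variable $x_j$ is isolated if $b_{ij}=0$ for $1\le i\le N$. Put $\mathbb A=\mathbb Z[x_{N+1},\dots,x_{N+M}]$ and $\bar{\mathbb A}=\mathbb Z[x_{N+1}^{\pm1},\dots,x_{N+M}^{\pm1}]$. For each $1\le i\le N$ fix a positive factor $d_i$ of $\gcd\{b_{ij}:1\le j\le N\}$. A seed is a triple $\Sigma=(\mathbf x,\widetilde B,\mathcal P)$, where $\mathbf x=(x_1,\dots,x_N)$ (the cluster) is a transcendence basis of $\mathcal F$ over the field of fractions of $\bar{\mathbb A}$, and $\mathcal P$ is a set of $N$ strings; the $i$th string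 is a collection of monomials $p_{ir}\in\mathbb A$, $0\le r\le d_i$, with $p_{i0}=p_{id_i}=1$ (it is trivial if $d_i=1$). The adjacent seed in direction $k$, $1\le k\le N$, is $(\mathbf x',\widetilde B',\mathcal P')$ with $\mathbf x'=(\mathbf x\setminus\{x_k\})\cup\{x_k'\}$, where $$x_kx_k'=\sum_{r=0}^{d_k}p_{kr}u_{k;>}^r v_{k;>}^{[r]}u_{k;<}^{d_k-r}v_{k;<}^{[d_k-r]},$$ $u_{k;>}=\prod\{x_i^{b_{ki}/d_k}:1\le i\le N,b_{ki}>0\}$, $u_{k;<}=\prod\{x_i^{-b_{ki}/d_k}:1\le i\le N,b_{ki}<0\}$, $v_{k;>}^{[r]}=\prod\{x_i^{\lfloor rb_{ki}/d_k\rfloor}:N+1\le i\le N+M,b_{ki}>0\}$, $v_{k;<}^{[r]}=\prod\{x_i^{\lfloor -rb_{ki}/d_k\rfloor}:N+1\le i\le N+M,b_{ki}<0\}$; $b'_{ij}=-b_{ij}$ if $i=k$ or $j=k$ and $b'_{ij}=b_{ij}+\frac12(|b_{ik}|b_{kj}+b_{ik}|b_{kj}|)$ otherwise; $p'_{kr}=p_{k,d_k-r}$ and $p'_{ir}=p_{ir}$ for $i\ne k$. The generalized cluster structure $\mathcal{GC}(\widetilde B,\mathcal P)$ is the set of all seeds obtained from $\Sigma$ by sequences of such mutations. The seeds are attached to the vertices of the $N$-regular tree $\mathbb T_N$ whose edges are labelled by the directions $1,\dots,N$ (the $N$ edges at each vertex have different labels), adjacent vertices carrying seeds adjacent in the direction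 of the edge label. The generalized upper cluster algebra $\overline{\mathcal A}(\widetilde B,\mathcal P)$ over $\widehat{\mathbb A}$ is the intersection of the rings $\widehat{\mathbb A}[\mathbf x^{\pm1}]$ of Laurent polynomials in cluster variables over all seeds. **The matrices $\widetilde B(i)$.** Let $L$ be the number of isolated variables. For the $i$th nontrivial string, $\widetilde B(i)$ is the $(d_i-1)\times L$ integer matrix whose $r$th row consists of the exponents of the isolated variables in the monomial $p_{ir}$, $1\le r\le d_i-1$. **Nerves and upper bounds.** A nerve $\mathcal N$ is a subtree of $\mathbb T_N$ on $N+1$ vertices all of whose edges have different labels. The upper bound $\overline{\mathcal A}(\mathcal N)$ is the intersection of the rings $\widehat{\mathbb A}[\mathbf x^{\pm1}]$ over all seeds in $\mathcal N$.
   Formalization: The ground ring is assumed to be a localization of A (each element is a/b with a, b in A and 1/b in the ground ring); for arbitrary rings between A and Ā the claim fails, e.g. Z[z,(s+1)/z,(t+1)/z] with x1x1'=s+1, x2x2'=t+1. *)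

(* Defs.v *)
From mathcomp Require Import all_boot all_order all_algebra.
From mathcomp Require Import fraction classical_sets mpoly.

Set Implicit Arguments.
Unset Strict Implicit.
Unset Printing Implicit Defensive.

Import Order.TTheory GRing.Theory Num.Theory.

Local Open Scope ring_scope.

(* The first N variables carry no particular meaning; the last M ones are the
   stable variables. *)
Notation ratfun N M := {fraction {mpoly rat[N + M]}}.

Definition stable_var (N M : nat) (j : 'I_M) : ratfun N M :=
  FracField.tofrac 'X_(rshift N j).

Arguments stable_var : clear implicits.

(** ** Subrings of a field, Laurent polynomials, transcendence bases *)

Record is_subring (F : fieldType) (R : set F) : Prop := IsSubring {
  subring1 : R 1;
  subringB : forall a b, R a -> R b -> R (a - b);
  subringM : forall a b, R a -> R b -> R (a * b) }.

(* R[x_0^{+-1}, ..., x_{n-1}^{+-1}]: finite sums of terms c * x^e, c in R. *)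
Definition laurent (F : fieldType) (n : nat) (R : set F) (x : 'I_n -> F) :
    set F :=
  [set f | exists s : seq (F * {ffun 'I_n -> int}),
     (forall t, t \in s -> R t.1) /\
     f = \sum_(t <- s) t.1 * \prod_(i < n) x i ^ t.2 i]%classic.

Definition frac_field (F : fieldType) (R : set F) : set F :=
  [set f | exists a b, [/\ R a, R b, b != 0 & f = a / b]]%classic.

Definition coef_in (F : fieldType) (n : nat) (K : set F) (P : {mpoly F[n]}) :
    Prop :=
  forall m, K P@_m.

(* The subfield K(x). *)
Definition adjoin (F : fieldType) (n : nat) (K : set F) (x : 'I_n -> F) :
    set F :=
  [set f | exists P Q : {mpoly F[n]},
     [/\ coef_in K P, coef_in K Q, Q.@[x] != 0 & f = P.@[x] / Q.@[x]]]%classic.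

Definition transcendence_basis (F : fieldType) (n : nat) (K : set F)
    (x : 'I_n -> F) : Prop :=
  (forall P : {mpoly F[n]}, coef_in K P -> P.@[x] = 0 -> P = 0) /\
  (forall f : F, exists q : {poly F},
     [/\ q != 0, forall i, adjoin K x q`_i & root q f]).

(* R is a ring of fractions of its subring A: it is obtained from A by inverting
   those elements of A that are units of R. *)
Definition is_localization (F : fieldType) (A R : set F) : Prop :=
  forall f, R f ->
    exists a b, [/\ A a, A b, b != 0, R b^-1 & f = a / b].

Definition stable_poly_ring (N M : nat) : set (ratfun N M) :=
  range (fun P : {mpoly int[M]} =>
    mmap (fun z : int => z%:~R) (stable_var N M) P).

Arguments stable_poly_ring : clear implicits.

Definition stable_laurent_ring (N M : nat) : set (ratfun N M) :=
  laurent (range (fun z : int => z%:~R)) (stable_var N M).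

Arguments stable_laurent_ring : clear implicits.

(** ** Exchange matrices *)

Definition int_rank (m n : nat) (A : 'M[int]_(m, n)) : nat :=
  \rank (map_mx (fun z : int => z%:~R : rat) A).

Definition skew_symmetrizable (n : nat) (A : 'M[int]_n) : Prop :=
  exists D : 'rV[int]_n,
    (forall i, 0 < D 0 i) /\ (diag_mx D *m A)^T = - (diag_mx D *m A).

Definition matrix_mutation (N M : nat) (k : 'I_N) (B : 'M[int]_(N, N + M)) :
    'M[int]_(N, N + M) :=
  \matrix_(i, j)
    if (i == k) || (j == lshift M k) then - B i j
    else let bik := B i (lshift M k) in
         B i j + ((`|bik| * B k j + bik * `|B k j|) %/ 2)%Z.

Definition isolated (N M : nat) (B : 'M[int]_(N, N + M)) : {set 'I_M} :=
  [set j | [forall i, B i (rshift N j) == 0]].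

(** ** Seeds *)

(* A monomial in the stable variables is given by its exponent vector. The
   integers d i do not change under mutation, hence are parameters. *)
Definition strings (N M : nat) (d : 'I_N -> nat) : Type :=
  forall i : 'I_N, 'I_(d i).+1 -> 'X_{1..M}.

Record seed (N M : nat) (d : 'I_N -> nat) : Type := Seed {
  cluster : 'I_N -> ratfun N M;
  exch_mx : 'M[int]_(N, N + M);
  string : strings M d }.

Arguments string {N M d} s i.

Record is_seed (N M : nat) (d : 'I_N -> nat) (S : seed M d) : Prop := IsSeed {
  seed_cluster :
    transcendence_basis (frac_field (stable_laurent_ring N M)) (cluster S);
  seed_principal : skew_symmetrizable (lsubmx (exch_mx S));
  seed_degree : forall i, (0 < d i)%N /\
    (d i %| \big[gcdn/0]_(j < N) `|exch_mx S i (lshift M j)|)%N;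
  seed_string : forall i, string S i ord0 = 0%MM /\
                          string S i ord_max = 0%MM }.

(* The matrix of exponents of the isolated variables in p_{i1}, ..., p_{i,d_i-1};
   its row r (counted from 0) comes from p_{i,r+1}. *)
Definition string_mx (N M : nat) (d : 'I_N -> nat) (S : seed M d) (i : 'I_N) :
    'M[int]_((d i).-1, #|isolated (exch_mx S)|) :=
  \matrix_(r, l) (string S i (inord r.+1) (enum_val l))%:Z.

Section Exchange.

Variables (N M : nat) (d : 'I_N -> nat) (S : seed M d) (k : 'I_N).

Let x := cluster S.
Let z := stable_var N M.
Let b (i : 'I_N) : int := exch_mx S k (lshift M i).
Let c (j : 'I_M) : int := exch_mx S k (rshift N j).
Let D : int := (d k)%:Z.

Definition u_gt : ratfun N M := \prod_(i < N | 0 < b i) x i ^ (b i %/ D)%Z.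

Definition u_lt : ratfun N M := \prod_(i < N | b i < 0) x i ^ ((- b i) %/ D)%Z.

(* For D > 0, (m %/ D)%Z is the integral part of m / D, also when m < 0. *)
Definition v_gt (r : nat) : ratfun N M :=
  \prod_(j < M | 0 < c j) z j ^ ((r%:Z * c j) %/ D)%Z.

Definition v_lt (r : nat) : ratfun N M :=
  \prod_(j < M | c j < 0) z j ^ ((- (r%:Z * c j)) %/ D)%Z.

Definition exchange_poly : ratfun N M :=
  \sum_(r < (d k).+1)
    mmap1 z (string S k r) *
    u_gt ^+ r * v_gt r * u_lt ^+ (d k - r) * v_lt (d k - r).

End Exchange.

Definition mutation (N M : nat) (d : 'I_N -> nat) (k : 'I_N) (S : seed M d) :
    seed M d :=
  {| cluster := fun i =>
       if i == k then exchange_poly S k / cluster S k else cluster S i;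
     exch_mx := matrix_mutation k (exch_mx S);
     string := fun i r => string S i (if i == k then rev_ord r else r) |}.

Definition cluster_structure (N M : nat) (d : 'I_N -> nat) (S : seed M d) :
    set (seed M d) :=
  [set S' | exists w : seq 'I_N, S' = foldr (@mutation N M d) S w]%classic.

(** ** The N-regular tree and nerves *)

(* T_N is realized on the words over the labels without two consecutive equal
   letters: the neighbour of w along the edge labelled k is k :: w if w does not
   start with k, and behead w otherwise. The empty word carries the initial
   seed. *)
Definition reduced (N : nat) (w : seq 'I_N) : bool :=
  sorted (fun a b => a != b) w.

Definition tree (N : nat) : Type := {w : seq 'I_N | reduced w}.

Definition edge (N : nat) (k : 'I_N) : rel (tree N) :=
  fun v w => (val w == k :: val v) || (val v == k :: val w).

Definition seed_at (N M : nat) (d : 'I_N -> nat) (S : seed M d) (v : tree N) :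
    seed M d :=
  foldr (@mutation N M d) S (val v).

(* A subtree of T_N is a nonempty connected set of vertices, together with all
   the edges of T_N between them. *)
Record is_nerve (N : nat) (W : seq (tree N)) : Prop := IsNerve {
  nerve_uniq : uniq W;
  nerve_size : size W = N.+1;
  nerve_connected : forall v w, v \in W -> w \in W ->
    exists p : seq (tree N),
      [/\ path (fun a b => [exists k, edge k a b]) v p,
          {subset p <= W} & last v p = w];
  nerve_labels : forall k v w v' w',
    v \in W -> w \in W -> v' \in W -> w' \in W ->
    edge k v w -> edge k v' w' -> (v = v' /\ w = w') \/ (v = w' /\ w = v') }.

(** ** Upper cluster algebras and upper bounds *)

Definition upper_cluster_algebra (N M : nat) (d : 'I_N -> nat) (S : seed M d)
    (R : set (ratfun N M)) : set (ratfun N M) :=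
  (\bigcap_(S' in cluster_structure S) laurent R (cluster S'))%classic.

Definition upper_bound (N M : nat) (d : 'I_N -> nat) (S : seed M d)
    (R : set (ratfun N M)) (W : seq (tree N)) : set (ratfun N M) :=
  (\bigcap_(v in [set` W]) laurent R (cluster (seed_at S v)))%classic.

(* Main.v *)
From HB Require Import structures.
Require Import Defs.
From Stdlib Require Import FunctionalExtensionality.
From mathcomp Require Import all_boot all_order all_algebra.
From mathcomp Require Import fraction classical_sets mpoly.
From mathcomp Require Import zify ring polyXY polydiv.

Set Implicit Arguments.
Unset Strict Implicit.
Unset Printing Implicit Defensive.

Import Order.TTheory GRing.Theory Num.Theory.

Local Open Scope ring_scope.

(** Write L(v) for the ring of Laurent polynomials with coefficients in Ahat in
    the cluster at the vertex v of the tree.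

    The theorem reduces to one step of propagation ([mutation_step]): if j <> k
    are directions at a seed T, then an element of L(T) and of L(mu_j mu_k T)
    lies in L(mu_j T).  Indeed, let f belong to the upper bound of a nerve.  The
    edge of the nerve labelled b can be slid, one vertex at a time, to the root
    of the nerve, because all the edges that it passes have labels different from
    b; so f is Laurent at the root and at all its neighbours.  This property of a
    vertex is inherited by the adjacent vertices, again by the step above, hence
    f is Laurent everywhere ([nerve_star], [star_everywhere]).

    For the step, let t be the j-th variable of T, let Y be the ring of Laurent
    polynomials in the other ones, and P in Y the exchange polynomial, so that
    P / t is the new variable of mu_j T.  Then L(T) = Y[t, t^-1], and L(mu_j T)
    contains Y[t, P / t], which consists of the sums of c_a t^a such that
    P^(-a) divides c_a in Y for all a < 0.  The variables of mu_j mu_k T lie in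
    Y[t, P / t], so the product of f with a monomial in them does, and these
    variables have to be cancelled.  Comparing lowest order terms in t shows that
    this is possible as soon as their values at t = 0 are regular modulo P
    ([rees_cancel]).  If b_jk <> 0, then at t = 0 the exchange polynomial of k
    reduces to one monomial, and the mutation rule of the matrix says exactly
    that the exchange polynomial of j in mu_k T becomes P times a monomial
    ([exchange_at0], [exchange_initial]).  Monomials in the stable variables are
    regular modulo P because no variable divides P.

    If b_jk = 0, the exchange polynomials P_j and P_k have to be coprime, and this
    is where the ranks enter ([exchange_regular]).  Give integral weights to the
    variables.  Since the rows j and k are independent, the weights of the
    non-isolated variables can be chosen so that the first and last monomials of
    P_k have equal weights while those of P_j do not; since the exponents of the
    isolated variables in the string of j are independent, the isolated variables
    can be weighted so that all the monomials of P_j but the last have the same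
    weight.  If tau records the weight, then P_j becomes U + m tau^c where m is a
    monomial, and division by it leaves remainders of degree less than c in tau.
    On the other hand, the terms of lowest degree in the isolated variables are a
    binomial m_0 + m tau^c for P_j and some w tau^b for P_k.  These are coprime, so
    a remainder whose product with P_k is divisible by P_j vanishes.

    The conditions on a seed used in all this are invariant under mutation
    ([good_mutation]). *)

(** * Integer polynomials and their values *)

Definition ev (n : nat) (R : comNzRingType) (X : 'I_n -> R) :
  {mpoly int[n]} -> R := mmap intr X.

Section Evaluation.
Variable n : nat.
Implicit Types (R : comNzRingType) (p : {mpoly int[n]}).

HB.instance Definition _ R (X : 'I_n -> R) :=
  GRing.RMorphism.on (ev X).

Lemma evE R (X : 'I_n -> R) p : ev X p = mmap (fun z : int => z%:~R) X p.
Proof. by []. Qed.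

Lemma evU R (X : 'I_n -> R) i : ev X 'X_i = X i.
Proof. by rewrite /ev mmapX mmap1U. Qed.

Lemma evX R (X : 'I_n -> R) m : ev X 'X_[m] = \prod_i X i ^+ m i.
Proof. by rewrite /ev mmapX. Qed.

(** The ring of integer polynomials is generated by the indeterminates. *)
Lemma ev_ind (Q : {mpoly int[n]} -> Prop) :
  Q 1 -> (forall p q, Q p -> Q q -> Q (p - q)) ->
  (forall p q, Q p -> Q q -> Q (p * q)) -> (forall i, Q 'X_i) ->
  forall p, Q p.
Proof.
move=> Q1 QB QM QX.
have Q0 : Q 0 by rewrite -(subrr 1); apply: QB.
have QN p : Q p -> Q (- p) by rewrite -[- p]add0r; apply: QB.
have QD p q : Q p -> Q q -> Q (p + q).
  by move=> Qp Qq; rewrite -[q]opprK; apply: QB => //; apply: QN.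
have Qn (k : nat) : Q k%:R by elim: k => // k IH; rewrite -addn1 natrD; apply: QD.
have QC c : Q c%:MP.
  have -> : c%:MP = c%:~R :> {mpoly int[n]} by rewrite -[in LHS](intz c) rmorph_int.
  case: c => k; first exact: Qn.
  by rewrite NegzE rmorphN; apply: QN; apply: Qn.
elim/mpolyind => [|c m p _ _ Qp]; first exact: Q0.
apply: QD => //; rewrite -mul_mpolyC; apply: (QM) => //.
rewrite mpolyXE_id; apply: (big_ind Q) => // i _.
by elim: (m i) => [|k IH]; rewrite ?expr0 // exprS; apply: QM.
Qed.

Lemma rmorph_ev R R' (f : {rmorphism R -> R'}) (X : 'I_n -> R) p :
  f (ev X p) = ev (f \o X) p.
Proof.
elim/ev_ind: p => [|p q IHp IHq|p q IHp IHq|i].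
- by rewrite !rmorph1.
- by rewrite !rmorphB /= IHp IHq.
- by rewrite !rmorphM /= IHp IHq.
- by rewrite !evU.
Qed.

Lemma eq_ev R (X X' : 'I_n -> R) p : X =1 X' -> ev X p = ev X' p.
Proof. by move=> eX; apply: eq_bigr => m _; rewrite (mmap1_eq _ eX). Qed.

Definition indet : 'I_n -> {mpoly int[n]} := fun i => 'X_i.

Lemma ev_id p : ev indet p = p.
Proof.
elim/ev_ind: p => [|p q IHp IHq|p q IHp IHq|i].
- by rewrite rmorph1.
- by rewrite rmorphB /= IHp IHq.
- by rewrite rmorphM /= IHp IHq.
- by rewrite evU.
Qed.

Lemma ev_closed R (Q : R -> Prop) (X : 'I_n -> R) :
  Q 1 -> (forall a b, Q a -> Q b -> Q (a - b)) ->
  (forall a b, Q a -> Q b -> Q (a * b)) -> (forall i, Q (X i)) ->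
  forall p, Q (ev X p).
Proof.
move=> Q1 QB QM QX; elim/ev_ind => [|p q|p q|i].
- by rewrite rmorph1.
- by rewrite rmorphB; apply: QB.
- by rewrite rmorphM; apply: QM.
- by rewrite evU.
Qed.

Definition setv R (X : 'I_n -> R) (k : 'I_n) (a : R) : 'I_n -> R :=
  fun i => if i == k then a else X i.

Lemma ev_setv0_dvd (k : 'I_n) p :
  exists q, p = ev (setv indet k 0) p + 'X_k * q.
Proof.
set K := setv indet k 0.
have expand (R : comNzRingType) (x y a b t : R) :
  (x + t * a) * (y + t * b) = x * y + t * (a * y + b * x + t * a * b) by ring.
elim/ev_ind: p => [|p q [a IHp] [b IHq]|p q [a IHp] [b IHq]|i].
- by exists 0; rewrite rmorph1 mulr0 addr0.
- by exists (a - b); rewrite rmorphB /= {1}IHp {1}IHq mulrBr opprD addrACA.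
- exists (a * ev K q + b * ev K p + 'X_k * a * b); rewrite rmorphM /= {1}IHp {1}IHq.
  exact: expand.
- exists (if i == k then 1 else 0); rewrite evU /K /setv.
  by case: eqP => [->|_]; rewrite ?mulr1 ?mulr0 ?add0r ?addr0.
Qed.

Lemma indet_neq0 k : indet k != 0.
Proof.
by apply/eqP => /(congr1 (ev (fun=> 1 : int))); rewrite evU rmorph0.
Qed.

(** An indeterminate generates a prime ideal, the kernel of its specialization
    to 0; it is therefore regular modulo every polynomial outside this ideal. *)
Lemma indet_dvd_cancel (k : 'I_n) (P c h : {mpoly int[n]}) :
  ev (setv indet k 0) P <> 0 -> indet k * c = P * h ->
  exists h', c = P * h'.
Proof.
set K := setv indet k 0 => P0 E; have := congr1 (ev K) E.
have Kk : ev K (indet k) = 0 by rewrite evU /K /setv eqxx.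
rewrite !rmorphM /= Kk mul0r => /esym/eqP.
rewrite mulf_eq0 => /orP[/eqP //|/eqP h0].
have [q hq] := ev_setv0_dvd k h; exists q.
apply: (mulfI (indet_neq0 k)).
by rewrite E {1}hq h0 add0r mulrCA.
Qed.
End Evaluation.

Global Opaque ev.

(** * Regular pairs of univariate polynomials from initial forms *)

Section InitialForms.
Variable A : idomainType.

(** The inner variable s measures the degree in the isolated variables: after
    division by the largest power of s, the value at s = 0 is the form of lowest
    degree. *)
Lemma initial_form (r : {poly {poly A}}) : r != 0 ->
  exists k r', [/\ r = ('X^k)%:P * r', map_poly (horner_eval 0) r' != 0 &
                   size r' = size r].
Proof.
move=> r0; have s0 : swapXY r != 0 by rewrite swapXY_eq0.
have [k [w w0 sE]] := multiplicity_XsubC (swapXY r) 0.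
rewrite s0 /= in w0; rewrite subr0 in sE.
have rE : r = ('X^k)%:P * swapXY w.
  by rewrite -[r]swapXYK sE rmorphM rmorphXn /= swapXY_X mulrC polyC_exp.
exists k, (swapXY w); split => //.
  by rewrite -horner_swapXY swapXYK.
by rewrite rE size_Cmul // expf_neq0 // polyX_eq0.
Qed.

(** [theta] is a grading of [A] in disguise: it multiplies a homogeneous element
    of degree n by s^n.  Then [init] keeps the part of degree 0. *)
Variable theta : {rmorphism A -> {poly A}}.
Hypothesis thetaK1 : forall a, (theta a).[1] = a.

Definition init (a : A) := (theta a).[0].

(** As [Q := m *: 'X^c + U%:P] has leading coefficient [m], some [m ^+ k *: H] has
    a remainder [r] modulo [Q] of degree less than [c], and [Q] divides [P2 * r].
    The forms of lowest degree satisfy the same divisibility; there [Q] becomes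
    [init m *: 'X^c + (init U)%:P] and [P2] becomes [w *: 'X^b], which are coprime
    because [init U != 0].  So [r = 0], for degree reasons. *)
Lemma regular_of_initial (U m w : A) (c b : nat) (P2 G H : {poly A}) :
    (0 < c)%N -> m != 0 -> init U != 0 -> init m != 0 -> w != 0 ->
    map_poly init P2 = w *: 'X^b ->
  (m *: 'X^c + U%:P) * G = P2 * H ->
  exists k q, m ^+ k *: H = (m *: 'X^c + U%:P) * q.
Proof.
move=> c0 m0 U0 im0 w0 P20 E; set Q := _ + _ in E *.
have sQ : size Q = c.+1.
  rewrite /Q size_polyDl ?size_scale ?size_polyXn //.
  by rewrite (leq_ltn_trans (size_polyC_leq1 _)).
have lQ : lead_coef Q = m.
  by rewrite lead_coefE sQ /= /Q coefD coefC coefZ coefXn eqxx gtn_eqF // addr0 mulr1.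
have Q0 : Q != 0 by rewrite -size_poly_eq0 sQ.
have dE := Pdiv.Idomain.divp_eq H Q; rewrite lQ in dE.
set k := scalp _ _ in dE; set q := H %/ Q in dE; set r := H %% Q in dE.
exists k, q; suff r0 : r = 0 by rewrite dE r0 addr0 mulrC.
have sr : (size r <= c)%N by rewrite -ltnS -sQ ltn_modp.
pose G' := m ^+ k *: G - P2 * q.
have E' : Q * G' = P2 * r.
  rewrite /G' mulrBr -scalerAr E scalerAr dE; ring.
clearbody r; apply/eqP/negPn/negP => r0.
(* the value at s = 1 is a left inverse of theta *)
have hinj p : map_poly theta p = 0 -> p = 0.
  move=> /polyP h; apply/polyP => i; have := h i; rewrite !coef0 coef_map /=.
  by move=> e; rewrite -[LHS]thetaK1 e horner0.
have [kr [r' [rE r'0 sr']]] : exists k r', [/\ map_poly theta r = ('X^k)%:P * r',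
   map_poly (horner_eval 0) r' != 0 & size r' = size (map_poly theta r)].
  by apply: initial_form; apply/eqP => /hinj e; rewrite e eqxx in r0.
have P2n : P2 != 0.
  apply/eqP => e; move/eqP: P20; rewrite e map_poly0 eq_sym scale_poly_eq0 (negPf w0).
  by rewrite -size_poly_eq0 size_polyXn.
have G0 : G' != 0.
  apply/eqP => e; move/eqP: E'; rewrite e mulr0 eq_sym mulf_eq0.
  by rewrite (negPf P2n) (negPf r0).
have [kg [g' [gE g'0 _]]] : exists k r', [/\ map_poly theta G' = ('X^k)%:P * r',
   map_poly (horner_eval 0) r' != 0 & size r' = size (map_poly theta G')].
  by apply: initial_form; apply/eqP => /hinj e; rewrite e eqxx in G0.
have E2 : ('X^kg)%:P * (map_poly theta Q * g') = ('X^kr)%:P * (map_poly theta P2 * r').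
  rewrite mulrCA -gE -rmorphM /= E' rmorphM /= rE; ring.
pose low := map_poly (horner_eval (0 : A)).
have lowth p : low (map_poly theta p) = map_poly init p.
  by rewrite /low -map_poly_comp_id0 ?horner_evalE ?horner0.
have lowQ : map_poly init Q = init m *: 'X^c + (init U)%:P.
  by rewrite -lowth /low /Q !rmorphD /= !map_polyC /= !map_polyZ /= map_polyXn /= map_polyXn.
have lowX l : (0 < l)%N -> low ('X^l)%:P = 0.
  by move=> l0; rewrite /low map_polyC /= horner_evalE hornerXn expr0n gtn_eqF.
have X0 l : ('X^l)%:P != 0 :> {poly {poly A}}.
  by rewrite polyC_eq0 -size_poly_eq0 size_polyXn.
have lQ0 : map_poly init Q != 0.
  rewrite lowQ -size_poly_eq0 size_polyDl ?size_scale ?size_polyXn //.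
  by rewrite (leq_ltn_trans (size_polyC_leq1 _)).
(* the forms of lowest degree of both sides must occur in the same degree *)
have key : map_poly init Q * low g' = map_poly init P2 * low r'.
  case: (ltngtP kg kr) => h.
  - move: E2; rewrite -(subnKC (ltnW h)) exprD polyCM -mulrA => /(mulfI (X0 kg)).
    move/(congr1 low); rewrite {2}/low !rmorphM /= -/low lowX ?subn_gt0 // mul0r.
    rewrite {1}/low rmorphM /= -/low lowth => /eqP; rewrite mulf_eq0 (negPf lQ0) /=.
    by rewrite (negPf g'0).
  - move: E2; rewrite -(subnKC (ltnW h)) exprD polyCM -mulrA => /(mulfI (X0 kr)).
    move/(congr1 low); rewrite {1}/low !rmorphM /= -/low lowX ?subn_gt0 // mul0r.
    rewrite {1}/low rmorphM /= -/low lowth P20 => /esym/eqP.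
    rewrite mulf_eq0 (negPf r'0) orbF scale_poly_eq0 (negPf w0).
    by rewrite -size_poly_eq0 size_polyXn.
  - move: E2; rewrite h => /(mulfI (X0 kr)) /(congr1 low).
    by rewrite /low !rmorphM /= -/low !lowth.
have cop : coprimep (map_poly init Q) (w *: 'X^b).
  rewrite coprimepZr // coprimep_expr // coprimepX.
  by rewrite lowQ /root hornerD hornerC hornerZ hornerXn expr0n gtn_eqF // mulr0 add0r.
have dv : map_poly init Q %| w *: 'X^b * low r' by rewrite -P20 -key dvdp_mulr.
rewrite Gauss_dvdpr // in dv; have := dvdp_leq r'0 dv.
rewrite lowQ size_polyDl ?size_scale ?size_polyXn; last 2 first => //.
  by rewrite (leq_ltn_trans (size_polyC_leq1 _)).
apply/negP; rewrite -leqNgt; apply: leq_trans (size_poly _ _) _.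
by rewrite sr' (leq_trans (size_poly _ _)).
Qed.
End InitialForms.

(** * Regular pairs of sums of monomials *)

Lemma clear_powers (K : fieldType) (t Q G H2 H pg ph p2 : K) (w : int)
    (k2 kh kg : nat) : t != 0 ->
    Q * t ^ w * pg = p2 * ph -> pg * t ^+ kg = G -> ph * t ^+ kh = H ->
    p2 * t ^+ k2 = H2 ->
  exists a b : nat, Q * (G * t ^+ a) = H2 * (H * t ^+ b).
Proof.
move=> t0 E <- <- <-.
have [a [b ab]] : exists a b : nat, kg%:Z + a%:Z = w + (k2 + kh + b)%:Z.
  pose s := w + (k2 + kh)%:Z; exists (absz s).
  by exists (absz (kg%:Z + (absz s)%:Z - s)%R); rewrite /s; lia.
exists a, b; transitivity (Q * pg * t ^ (kg%:Z + a%:Z)).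
  by rewrite expfzDr // -!exprnP -!mulrA.
transitivity (Q * t ^ w * pg * t ^+ (k2 + kh + b)).
  by rewrite ab expfzDr // -!mulrA [pg * _]mulrCA.
by rewrite E !exprD !mulrA -(mulrA p2) (mulrC ph) !mulrA.
Qed.

Section RegularPairs.
Variable n : nat.
Local Notation A := {mpoly int[n]}.

Lemma ev_prod_indet (m : 'X_{1..n}) : 'X_[m] = \prod_i indet i ^+ m i :> A.
Proof. by rewrite -[LHS]ev_id evX. Qed.

Lemma mon_dvd_cancel (m : 'X_{1..n}) (P c h : A) :
  (forall i, ev (setv (@indet n) i 0) P <> 0) -> 'X_[m] * c = P * h ->
  exists h', c = P * h'.
Proof.
move=> P0; rewrite ev_prod_indet.
elim: (index_enum _) c h => [|i s IH] c h; first by rewrite big_nil mul1r; exists h.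
rewrite big_cons -mulrA; elim: (m i) h => [|k IHk] h.
  by rewrite expr0 mul1r; apply: IH.
by rewrite exprS -mulrA => /(indet_dvd_cancel (P0 i)) [h' /IHk].
Qed.

Definition sum_mon D (E : 'I_D -> 'X_{1..n}) : A := \sum_r 'X_[E r].

Lemma ev_sum_mon (R : comNzRingType) (X : 'I_n -> R) D (E : 'I_D -> 'X_{1..n}) :
  ev X (sum_mon E) = \sum_r \prod_i X i ^+ E r i.
Proof. by rewrite raddf_sum /=; apply: eq_bigr => r _; rewrite evX. Qed.

(** The value at the point (1, .., 1) counts the monomials. *)
Lemma sum_mon_neq0 D (E : 'I_D.+1 -> 'X_{1..n}) (C : pred 'I_D.+1) r0 :
  C r0 -> \sum_(r | C r) 'X_[E r] <> 0 :> A.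
Proof.
move=> Cr0 /(congr1 (ev (fun=> 1 : int))); rewrite raddf_sum /= rmorph0.
rewrite (eq_bigr (fun=> 1)) => [|r _]; last first.
  by rewrite evX big1 // => i _; rewrite expr1n.
rewrite -[LHS]/(\sum_(r in C) 1) sumr_const => /eqP; rewrite pnatr_eq0 => /eqP /card0_eq /(_ r0).
by rewrite unfold_in Cr0.
Qed.

Lemma sum_mon_indet0 D (E : 'I_D.+1 -> 'X_{1..n}) i r0 : E r0 i = 0%N ->
  ev (setv (@indet n) i 0) (sum_mon E) <> 0.
Proof.
move=> Er0 e; apply: (@sum_mon_neq0 _ E (fun r => E r i == 0%N) r0); first exact/eqP.
rewrite -[RHS]e ev_sum_mon big_mkcond /=; apply: eq_bigr => r _.
rewrite ev_prod_indet (bigD1 i) //= [RHS](bigD1 i) //= /setv eqxx.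
case: eqP => [->|/eqP Ei]; last by rewrite expr0n (negPf Ei) mul0r.
by congr (_ * _); apply: eq_bigr => j /negPf ->.
Qed.

Section Twist.
Variables (iso : pred 'I_n) (lam : 'I_n -> int).

Definition weight (m : 'X_{1..n}) : int := \sum_i lam i * (m i)%:Z.

Definition theta : A -> {poly A} :=
  ev (fun i => if iso i then indet i *: 'X else (indet i)%:P).
HB.instance Definition _ := GRing.RMorphism.on theta.

Lemma thetaK1 a : (theta a).[1] = a.
Proof.
rewrite -[LHS]/(horner_eval 1 (theta a)) /theta rmorph_ev -[RHS]ev_id.
by apply: eq_ev => i /=; case: ifP => _; rewrite horner_evalE ?hornerZ ?hornerX ?hornerC ?mulr1.
Qed.

Lemma init_mon m :
  init theta 'X_[m] = if [forall (i | iso i), m i == 0%N] then 'X_[m] else 0.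
Proof.
rewrite /init -[LHS]/(horner_eval 0 (theta 'X_[m])) /theta rmorph_ev evX.
case: ifPn => [/forallP h|].
  rewrite ev_prod_indet; apply: eq_bigr => i _ /=; have := h i; case: ifP => _.
    by move/eqP => ->; rewrite !expr0.
  by rewrite horner_evalE hornerC.
rewrite negb_forall => /existsP[i]; rewrite negb_imply => /andP[ii mi].
by rewrite (bigD1 i) //= ii horner_evalE hornerZ hornerX mulr0 expr0n (negPf mi) mul0r.
Qed.

Lemma init_sum (I : finType) (C : pred I) (F : I -> A) :
  init theta (\sum_(i | C i) F i) = \sum_(i | C i) init theta (F i).
Proof. by rewrite /init raddf_sum horner_sum. Qed.

Let K := {fraction {poly A}}.
Let tau : K := FracField.tofrac 'X.
(** The substitution is made in a field because weights may be negative. *)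
Definition twist : A -> K :=
  ev (fun i => FracField.tofrac (indet i)%:P * tau ^ lam i).
HB.instance Definition _ := GRing.RMorphism.on twist.

Lemma tau_neq0 : tau != 0.
Proof. by rewrite tofrac_eq0 polyX_eq0. Qed.

Lemma twist_mon m :
  twist 'X_[m] = FracField.tofrac 'X_[m]%:P * tau ^ weight m.
Proof.
rewrite /twist evX ev_prod_indet !rmorph_prod /weight.
rewrite (big_morph (fun z : int => tau ^ z) (fun a b => expfzDr a b tau_neq0) (expr0z _)) -big_split /=.
apply: eq_bigr => i _; rewrite exprMn !rmorphXn /=; congr (_ * _).
by rewrite exprnP -exprz_exp.
Qed.

Lemma twist_clear p :
  exists k (H : {poly A}), twist p * tau ^+ k = FracField.tofrac H /\ H.[1] = p.
Proof.
elim/ev_ind: p => [|p q [a [F [IHp Fp]]] [b [G [IHq Gq]]]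
                   |p q [a [F [IHp Fp]]] [b [G [IHq Gq]]]|i].
- by exists 0%N, 1; rewrite !rmorph1 mul1r hornerC.
- exists (a + b)%N, (F * 'X^b - G * 'X^a); split; last first.
    by rewrite !hornerE ?hornerXn !expr1n !mulr1 Fp Gq.
  rewrite !rmorphB !rmorphM /= !rmorphXn /= -/tau -IHp -IHq exprD mulrBl.
  by rewrite mulrA [tau ^+ a * _]mulrC mulrA.
- exists (a + b)%N, (F * G); split; last by rewrite hornerM Fp Gq.
  by rewrite !rmorphM /= -IHp -IHq exprD mulrACA.
- rewrite /twist evU; case: (lam i) => l.
    exists 0%N, ((indet i)%:P * 'X^l); rewrite mulr1 rmorphM rmorphXn; split => //.
    by rewrite !hornerE ?hornerXn expr1n mulr1.
  exists l.+1, (indet i)%:P; rewrite hornerC; split => //.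
  by rewrite NegzE -exprnN mulfVK // expf_neq0 // tau_neq0.
Qed.
End Twist.

Variables (iso : pred 'I_n) (lam : 'I_n -> int) (d1 d2 : nat).
Variables (E1 : 'I_d1.+1 -> 'X_{1..n}) (E2 : 'I_d2.+1 -> 'X_{1..n}).

Definition no_iso (m : 'X_{1..n}) := [forall (i | iso i), m i == 0%N].

(** The polynomial [sum_mon E1] is twisted into [tau ^ w1] times [U + m tau^c],
    where [m] is its last monomial.  In [sum_mon E2], only the monomials without
    isolated variables survive in the initial form, and they have one weight, so
    [regular_of_initial] applies.  It yields divisibility up to a power of [m],
    which is removed because no indeterminate divides [sum_mon E1]. *)
Lemma regular_sum_mon (g h : A) :
    (0 < d1)%N ->
    (forall i, exists r, E1 r i = 0%N) ->
    no_iso (E1 ord0) -> no_iso (E1 ord_max) ->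
    (forall r : 'I_d1.+1, (r < d1)%N -> weight lam (E1 r) = weight lam (E1 ord0)) ->
    (weight lam (E1 ord0) < weight lam (E1 ord_max))%R ->
    no_iso (E2 ord0) ->
    (forall r, no_iso (E2 r) -> weight lam (E2 r) = weight lam (E2 ord0)) ->
  sum_mon E1 * g = sum_mon E2 * h -> exists q, h = sum_mon E1 * q.
Proof.
case: d1 E1 => // D F1 _ prim n0 nD wt1 wtD n2 wt2 E.
set w1 := weight lam (F1 ord0) in wt1 wtD *.
pose m : A := 'X_[F1 ord_max].
pose U : A := \sum_(r < D.+1) 'X_[F1 (widen_ord (leqnSn _) r)].
have P1E : sum_mon F1 = U + m by rewrite /sum_mon big_ord_recr.
have [c cE] : exists c, weight lam (F1 ord_max) = w1 + c%:Z.
  by exists `|weight lam (F1 ord_max) - w1|%N; lia.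
have c0 : (0 < c)%N by lia.
pose tau : {fraction {poly A}} := FracField.tofrac 'X.
have tau0 : tau != 0 by exact: tau_neq0.
have tw1 : twist lam (sum_mon F1) = FracField.tofrac (m *: 'X^c + U%:P) * tau ^ w1.
  rewrite P1E rmorphD /= addrC rmorphD mulrDl twist_mon; congr (_ + _).
    rewrite cE -/tau expfzDr // mulrA -mul_polyC rmorphM rmorphXn /= -!mulrA.
    by congr (_ * _); rewrite mulrC.
  rewrite /U !rmorph_sum mulr_suml; apply: eq_bigr => r _.
  by rewrite -[LHS]/(twist lam _) twist_mon wt1 //=.
(* a power of tau which makes all the exponents of tau nonnegative *)
have [k2 hk2] : exists k : nat, forall r, (0 <= weight lam (E2 r) + k%:Z)%R.
  exists (\sum_r absz (weight lam (E2 r)))%N => r.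
  by rewrite (bigD1 r) //=; lia.
pose e2 r := absz (weight lam (E2 r) + k2%:Z)%R.
pose H2 : {poly A} := \sum_r 'X_[E2 r] *: 'X^(e2 r).
have tw2 : twist lam (sum_mon E2) * tau ^+ k2 = FracField.tofrac H2.
  rewrite !rmorph_sum mulr_suml; apply: eq_bigr => r _ /=.
  rewrite twist_mon -mul_polyC rmorphM rmorphXn -/tau -mulrA; congr (_ * _).
  by rewrite -[tau ^+ k2]/(tau ^ k2%:Z) -expfzDr // /e2 -[RHS]/(tau ^ _%:Z) gez0_abs.
have [kg [G [Gg G1]]] := twist_clear lam g.
have [kh [H [Hh H1]]] := twist_clear lam h.
rewrite -/tau in Gg Hh.
have [G' [H' [EQ H'1]]] : exists (G' H' : {poly A}),
    (m *: 'X^c + U%:P) * G' = H2 * H' /\ H'.[1] = h.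
  have Et := congr1 (twist lam) E.
  rewrite !rmorphM /= tw1 in Et.
  have [a [b ab]] := clear_powers tau0 Et Gg Hh tw2.
  exists (G * 'X^a), (H * 'X^b); split; last first.
    by rewrite hornerM hornerXn expr1n mulr1.
  by apply/eqP; rewrite -tofrac_eq !tofracM !tofracXn -/tau; apply/eqP.
pose w : A := \sum_(r | no_iso (E2 r)) 'X_[E2 r].
have nz (e : 'X_{1..n}) : 'X_[e] != 0 :> A.
  apply/eqP => /(congr1 (ev (fun=> 1 : int))); rewrite evX rmorph0 big1 //.
  by move=> i _; rewrite expr1n.
have U0 : init (theta iso) U != 0.
  rewrite init_sum; under eq_bigr => r _ do rewrite init_mon.
  rewrite -big_mkcond; apply/eqP; apply: (@sum_mon_neq0 _ _ _ ord0) => /=.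
  by have -> : widen_ord (leqnSn D.+1) ord0 = ord0 by apply: val_inj.
have H20 : map_poly (init (theta iso)) H2 = w *: 'X^(e2 ord0).
  have initP : map_poly (init (theta iso)) H2
      = \sum_r init (theta iso) 'X_[E2 r] *: 'X^(e2 r).
    apply/polyP => i; rewrite coef_map_id0; last by rewrite /init rmorph0 horner0.
    rewrite !coef_sum init_sum; apply: eq_bigr => r _.
    rewrite !coefZ !coefXn; case: eqP => _; rewrite ?mulr1 // !mulr0.
    by rewrite /init rmorph0 horner0.
  rewrite initP scaler_suml [RHS]big_mkcond; apply: eq_bigr => r _.
  rewrite init_mon -/(no_iso _); case: ifP => [/wt2 e|_]; last by rewrite scale0r.
  by rewrite /e2 e.
have im0 : init (theta iso) m != 0 by rewrite init_mon -/(no_iso _) nD.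
have w0 : w != 0 by apply/eqP; apply: (@sum_mon_neq0 _ _ _ ord0).
have [k [q qE]] := regular_of_initial (@thetaK1 iso) c0 (nz _) U0 im0 w0 H20 EQ.
have /mon_dvd_cancel : 'X_[F1 ord_max *+ k] * h = sum_mon F1 * q.[1].
  have := congr1 (horner_eval 1) qE.
  rewrite !horner_evalE hornerZ H'1 hornerM hornerD hornerZ hornerXn expr1n mulr1 hornerC.
  by rewrite P1E mpolyXn addrC.
apply => i; have [r] := prim i; exact: sum_mon_indet0.
Qed.
End RegularPairs.

(** * Subrings and Laurent polynomials *)

Section Subrings.
Variables (F : fieldType) (Q : set F).
Hypothesis sQ : is_subring Q.

Lemma subring0 : Q 0.
Proof. by rewrite -(subrr 1); apply: subringB => //; apply: subring1. Qed.

Lemma subringN a : Q a -> Q (- a).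
Proof. by move=> Qa; rewrite -[- a]add0r; apply: subringB => //; apply: subring0. Qed.

Lemma subringD a b : Q a -> Q b -> Q (a + b).
Proof. by move=> Qa Qb; rewrite -[b]opprK; apply: subringB => //; apply: subringN. Qed.

Lemma subring_sum I (s : seq I) (C : pred I) (f : I -> F) :
  (forall i, C i -> Q (f i)) -> Q (\sum_(i <- s | C i) f i).
Proof. by move=> h; apply: (big_ind Q) => //; [apply: subring0|apply: subringD]. Qed.

Lemma subring_prod I (s : seq I) (C : pred I) (f : I -> F) :
  (forall i, C i -> Q (f i)) -> Q (\prod_(i <- s | C i) f i).
Proof. by move=> h; apply: (big_ind Q) => //; [apply: subring1|apply: subringM]. Qed.

Lemma subringX a k : Q a -> Q (a ^+ k).
Proof.
move=> Qa; elim: k => [|k IH]; first exact: subring1.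
by rewrite exprS; apply: subringM.
Qed.

Lemma subringXz a (z : int) : Q a -> Q a^-1 -> Q (a ^ z).
Proof.
move=> Qa Qa'; case: z => k; first exact: subringX.
by rewrite NegzE -exprnN -exprVn; apply: subringX.
Qed.

Lemma subring_ev n (X : 'I_n -> F) p : (forall i, Q (X i)) -> Q (ev X p).
Proof.
by move=> QX; apply: (@ev_closed n F Q X (subring1 sQ) (subringB sQ) (subringM sQ) QX p).
Qed.
End Subrings.

Section Laurent.
Variables (F : fieldType) (n : nat) (R : set F) (x : 'I_n -> F).
Hypothesis sR : is_subring R.

Lemma laurent_mon (c : F) (e : 'I_n -> int) :
  R c -> laurent R x (c * \prod_i x i ^ e i).
Proof.
move=> Rc; exists [:: (c, [ffun i => e i])]; split.
  by move=> u; rewrite inE => /eqP ->.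
by rewrite big_seq1 /=; congr (_ * _); apply: eq_bigr => i _; rewrite ffunE.
Qed.

Lemma laurent_coef c : R c -> laurent R x c.
Proof.
move=> Rc; have := laurent_mon (fun=> 0) Rc.
by rewrite big1 ?mulr1 // => i _; rewrite expr0z.
Qed.

Lemma laurent_varz i (z : int) : laurent R x (x i ^ z).
Proof.
have := laurent_mon (fun j => if j == i then z else 0) (subring1 sR).
rewrite (bigD1 i) //= eqxx big1 ?mulr1 ?mul1r // => j /negPf ->.
by rewrite expr0z.
Qed.

Lemma laurent_var i : laurent R x (x i).
Proof. exact: (laurent_varz i 1). Qed.

Lemma laurent_varV i : laurent R x (x i)^-1.
Proof. exact: (laurent_varz i (-1)). Qed.

Lemma laurent_min (Q : set F) : is_subring Q ->
  (R `<=` Q)%classic -> (forall i, Q (x i)) -> (forall i, Q (x i)^-1) ->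
  (laurent R x `<=` Q)%classic.
Proof.
move=> sQ RQ Qx QxV f [s [sR' ->]].
rewrite big_seq; apply: subring_sum => // u us; apply: subringM => //.
  by apply: RQ; apply: sR'.
by apply: subring_prod => // i _; apply: subringXz.
Qed.

Hypothesis x0 : forall i, x i != 0.

Lemma laurent_subring : is_subring (laurent R x).
Proof.
have D f g : laurent R x f -> laurent R x g -> laurent R x (f + g).
  move=> [s [hs ->]] [s' [hs' ->]]; exists (s ++ s'); rewrite big_cat.
  by split => // u; rewrite mem_cat => /orP[]; auto.
split.
- by apply: laurent_coef; apply: subring1.
- move=> f g Lf [s [hs ->]]; apply: D => //.
  exists [seq (- u.1, u.2) | u <- s]; split.
    by move=> u /mapP[v vs ->]; apply: subringN => //; apply: hs.
  by rewrite big_map -sumrN; apply: eq_bigr => u _; rewrite mulNr.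
- move=> f g [s [hs ->]] [s' [hs' ->]].
  pose mul (u v : F * {ffun 'I_n -> int}) := (u.1 * v.1, [ffun i => u.2 i + v.2 i]).
  exists [seq mul u v | u <- s, v <- s']; split.
    by move=> w /allpairsP[[u v] [us vs ->]]; apply: subringM => //; [apply: hs|apply: hs'].
  rewrite big_allpairs_dep mulr_suml; apply: eq_bigr => u _.
  rewrite mulr_sumr; apply: eq_bigr => v _; rewrite mulrACA -big_split /=.
  by congr (_ * _); apply: eq_bigr => i _; rewrite ffunE expfzDr.
Qed.

(** The elements that some power of the product of the variables sends to [Q]
    form a subring, which contains the inverses of the variables. *)
Lemma laurent_clear (Q : set F) f : is_subring Q ->
  (R `<=` Q)%classic -> (forall i, Q (x i)) -> laurent R x f ->
  exists k, Q (f * \prod_i x i ^+ k).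
Proof.
move=> sQ RQ Qx.
have QX k : Q (\prod_i x i ^+ k).
  by apply: subring_prod => // i _; apply: subringX.
have XD a b : \prod_i x i ^+ (a + b) = (\prod_i x i ^+ a) * \prod_i x i ^+ b.
  by rewrite -big_split; apply: eq_bigr => i _; rewrite exprD.
apply: (@laurent_min (fun f => exists k, Q (f * \prod_i x i ^+ k))%classic).
- split; first by exists 0%N; rewrite mul1r; apply: QX.
  + move=> a b [j Qa] [k Qb]; exists (j + k)%N; rewrite mulrBl; apply: subringB => //.
      by rewrite XD mulrA; apply: subringM.
    by rewrite addnC XD mulrA; apply: subringM.
  + move=> a b [j Qa] [k Qb]; exists (j + k)%N; rewrite XD mulrACA.
    exact: subringM.
- by move=> c Rc; exists 0%N; apply: subringM => //; apply: RQ.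
- by move=> i; exists 0%N; apply: subringM.
- move=> i; exists 1%N; rewrite (bigD1 i) //= mulrA expr1 mulVf // mul1r.
  by apply: subring_prod => // j _; apply: subringX.
Qed.
End Laurent.

(** * The ring Y[t, P / t] *)

Section Filtration.
Variables (F : fieldType) (Y : set F) (t P : F).
Hypothesis sY : is_subring Y.
Hypothesis YP : Y P.

Definition in_power (m : nat) (a : F) := exists2 c, Y c & a = P ^+ m * c.

Definition regular_mod (u : F) := forall c, Y c -> in_power 1 (u * c) -> in_power 1 c.

(** If [p] is the numerator of [p.[t] / t ^+ m], the coefficient of [t^(i - m)] must
    be divisible by [P ^+ (m - i)]; the truncated subtraction also accounts for
    the nonnegative powers of [t], where the condition is membership in [Y]. *)
Definition rees (m : nat) (p : {poly F}) := forall i, in_power (m - i) p`_i.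

Definition rees_ring : set F :=
  [set f | exists m p, rees m p /\ f * t ^+ m = p.[t]]%classic.

Definition laurent1 : set F :=
  [set f | exists m (p : {poly F}), (forall i, Y p`_i) /\ f * t ^+ m = p.[t]]%classic.

Lemma in_power_le m k a : (m <= k)%N -> in_power k a -> in_power m a.
Proof.
move=> mk [c Yc ->]; exists (P ^+ (k - m) * c); last by rewrite mulrA -exprD subnKC.
by apply: subringM => //; apply: subringX.
Qed.

Lemma in_powerM m k a b : in_power m a -> in_power k b -> in_power (m + k) (a * b).
Proof.
by move=> [c Yc ->] [e Ye ->]; exists (c * e); [apply: subringM|rewrite exprD mulrACA].
Qed.

Lemma in_powerB m a b : in_power m a -> in_power m b -> in_power m (a - b).
Proof.
by move=> [c Yc ->] [e Ye ->]; exists (c - e); [apply: subringB|rewrite mulrBr].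
Qed.

Lemma in_power_0 m : in_power m 0.
Proof. by exists 0; rewrite ?mulr0 //; apply: subring0. Qed.

Lemma in_power0 a : in_power 0 a <-> Y a.
Proof. by split=> [[c Yc ->]|Ya]; [rewrite mul1r|exists a => //; rewrite mul1r]. Qed.

Lemma in_power_sum m I (s : seq I) (C : pred I) (f : I -> F) :
  (forall i, C i -> in_power m (f i)) -> in_power m (\sum_(i <- s | C i) f i).
Proof.
move=> h; apply: (big_ind (in_power m)) => //; first exact: in_power_0.
move=> a b ha hb; rewrite -[b]opprK; apply: in_powerB => //; rewrite -[- b]add0r.
by apply: in_powerB => //; apply: in_power_0.
Qed.

Lemma reesM m k p q : rees m p -> rees k q -> rees (m + k) (p * q).
Proof.
move=> hp hq i; rewrite coefM; apply: in_power_sum => j _.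
apply: in_power_le (in_powerM (hp j) (hq (i - j)%N)); have := ltn_ord j; lia.
Qed.

Lemma reesMX m p k : rees m p -> rees (m + k) (p * 'X^k).
Proof.
move=> hp i; rewrite coefMXn; case: ltnP => h; first exact: in_power_0.
by apply: in_power_le (hp _); lia.
Qed.

Lemma rees_ring_subring : is_subring rees_ring.
Proof.
split.
- exists 0%N, 1; split; last by rewrite hornerC mulr1.
  move=> i; rewrite sub0n; apply/in_power0; rewrite coefC.
  by case: eqP => _; [apply: subring1|apply: subring0].
- move=> a b [m [p [hp ea]]] [k [q [hq eb]]].
  exists (m + k)%N, (p * 'X^k - q * 'X^m); split.
    move=> i; rewrite coefB; apply: in_powerB; first exact: reesMX.
    by rewrite addnC; apply: reesMX.
  by rewrite hornerD hornerN !hornerM !hornerXn -ea -eb exprD; ring.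
- move=> a b [m [p [hp ea]]] [k [q [hq eb]]]; exists (m + k)%N, (p * q).
  split; first exact: reesM.
  by rewrite hornerM -ea -eb exprD; ring.
Qed.

Lemma rees_ringY c : Y c -> rees_ring c.
Proof.
move=> Yc; exists 0%N, c%:P; split; last by rewrite hornerC mulr1.
move=> i; apply/in_power0; rewrite coefC.
by case: eqP => _ //; apply: subring0.
Qed.

Lemma laurent1_subring : is_subring laurent1.
Proof.
have YM (p q : {poly F}) : (forall i, Y p`_i) -> (forall i, Y q`_i) -> forall i, Y (p * q)`_i.
  by move=> hp hq i; rewrite coefM; apply: subring_sum => // j _; apply: subringM.
have YX k i : Y ('X^k : {poly F})`_i.
  by rewrite coefXn; case: eqP => _; [apply: subring1|apply: subring0].
split.
- exists 0%N, 1; split; last by rewrite hornerC mulr1.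
  by have := YX 0%N; rewrite expr0.
- move=> a b [m [p [hp ea]]] [k [q [hq eb]]].
  exists (m + k)%N, (p * 'X^k - q * 'X^m); split.
    by move=> i; rewrite coefB; apply: subringB => //; apply: YM.
  by rewrite hornerD hornerN !hornerM !hornerXn -ea -eb exprD; ring.
- move=> a b [m [p [hp ea]]] [k [q [hq eb]]]; exists (m + k)%N, (p * q).
  split; first exact: YM.
  by rewrite hornerM -ea -eb exprD; ring.
Qed.

Hypothesis P0 : P != 0.
Hypothesis t0 : t != 0.
Hypothesis t_free : forall p : {poly F}, (forall i, Y p`_i) -> p.[t] = 0 -> p = 0.

Lemma regular_power u m c : regular_mod u -> Y c -> in_power m (u * c) -> in_power m c.
Proof.
move=> ru; elim: m c => [|m IH] c Yc h; first exact/in_power0.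
have [c' Yc' cE] : in_power 1 c by apply: ru => //; apply: in_power_le h.
have /IH [//|e Ye eE] : in_power m (u * c').
  case: h => e Ye; rewrite cE expr1 mulrCA exprS -mulrA => /(mulfI P0) ->.
  by exists e.
by exists e => //; rewrite cE eE mulrA expr1 -exprS.
Qed.

(** Lowest order terms in [t]: the coefficient of [t^i] in the product of the
    numerators is [p`_i * u * P ^+ m], up to terms which by induction on [i] are
    already known to be divisible by [P ^+ (k + m - i)]; and [u] can be cancelled
    modulo powers of [P]. *)
Lemma rees_cancel f g m q u : laurent1 f -> g * t ^+ m = q.[t] -> rees m q ->
  Y u -> q`_0 = u * P ^+ m -> regular_mod u -> rees_ring (f * g) -> rees_ring f.
Proof.
move=> [k [p [Yp fE]]] gE hq Yu q0 ru [k' [p' [hp' fgE]]].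
exists k, p; split => //.
have YR l r : rees l r -> forall i, Y r`_i.
  by move=> h i; apply/in_power0; apply: in_power_le (h i).
have E : p * q * 'X^k' = p' * 'X^(k + m).
  apply/eqP; rewrite -subr_eq0; apply/eqP; apply: t_free.
    move=> i; rewrite coefB !coefMXn; apply: subringB => //.
      case: ifP => _; first exact: subring0.
      rewrite coefM; apply: subring_sum => // j _; apply: subringM => //.
      exact: YR hq _.
    by case: ifP => _; [apply: subring0|apply: YR hp' _].
  rewrite hornerD hornerN !hornerM !hornerXn -fE -gE -fgE exprD; ring.
have hpq i : in_power (k + m - i) (p * q)`_i.
  have := congr1 (fun r : {poly F} => r`_(i + k')) E.
  rewrite !coefMXn ltnNge leq_addl /= addnK => ->.
  case: ltnP => h; first exact: in_power_0.
  by apply: in_power_le (hp' _); lia.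
elim/ltn_ind => i IH.
have [ki|ik] := leqP k i; first by apply: in_power_le (_ : in_power 0 _); [lia|apply/in_power0].
have h : in_power (k + m - i) (p`_i * u * P ^+ m).
  have -> : p`_i * u * P ^+ m = (p * q)`_i - \sum_(j < i) p`_j * q`_(i - j).
    by rewrite coefM big_ord_recr /= subnn q0 addrAC subrr add0r mulrA.
  apply: in_powerB => //; apply: in_power_sum => j _.
  by apply: in_power_le (in_powerM (IH j (ltn_ord j)) (hq (i - j)%N)); have := ltn_ord j; lia.
apply: (regular_power ru) => //; case: h => c Yc cE; exists c => //.
apply: (mulIf (expf_neq0 m P0)); rewrite [u * _]mulrC cE mulrAC -exprD.
by congr (_ ^+ _ * _); lia.
Qed.
End Filtration.

(** * Exchange polynomials *)

Section Exponents.
Implicit Types (b : int) (d r : nat).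

Definition pos_part (b : int) : int := Num.max 0 b.

Lemma pos_partE b : pos_part b = if 0 <= b then b else 0.
Proof. by rewrite /pos_part; case: (leP 0 b). Qed.

Lemma pos_part_ge0 b : 0 <= pos_part b.
Proof. by rewrite pos_partE; case: ifP. Qed.

Lemma pos_partN b : pos_part b - pos_part (- b) = b.
Proof. by rewrite !pos_partE; do 2!case: ifP; lia. Qed.

(** The exponent with which a variable occurs in the r-th term of the exchange
    polynomial, if b is its entry in the exchange matrix.  This one formula covers
    cluster and stable variables, and both signs of b: for b > 0 it is the integral
    part of r b / d, for b < 0 the one of (d - r) (- b) / d. *)
Definition expo b d r : int := pos_part (- b) + ((r%:Z * b) %/ d%:Z)%Z.

Lemma expo0 b d : expo b d 0 = pos_part (- b).
Proof. by rewrite /expo mul0r div0z addr0. Qed.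

Lemma expo_full b d : (0 < d)%N -> expo b d d = pos_part b.
Proof. by move=> d0; rewrite /expo mulKz; [have := pos_partN b; lia|lia]. Qed.

(** Mutation in direction k changes the sign of the k-th row and reverses the k-th
    string, hence does not change the exchange polynomial. *)
Lemma expo_rev b d r : (0 < d)%N -> (r <= d)%N -> expo (- b) d (d - r) = expo b d r.
Proof.
move=> d0 rd; rewrite /expo opprK.
have -> : (d - r)%N%:Z * (- b) = (- b) * d%:Z + r%:Z * b by rewrite -subzn //; ring.
by rewrite divzMDl; [have := pos_partN b; lia|lia].
Qed.

Lemma expo_ge0 b d r : (0 < d)%N -> (r <= d)%N -> 0 <= expo b d r.
Proof.
move=> d0 rd; have [b0|b0] := leP 0 b.
  by rewrite addr_ge0 ?pos_part_ge0 // divz_ge0 ?mulr_ge0 //; lia.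
rewrite -expo_rev // addr_ge0 ?pos_part_ge0 // divz_ge0 ?mulr_ge0 //; lia.
Qed.

(** The mutated row is of the form [b + d g m]; the last term, linear in [r], is the
    one that the substitution of the mutated variable compensates. *)
Lemma expo_shift b d r (g m : int) : (0 < d)%N ->
  expo (b + d%:Z * g * m) d r
  = expo b d r + (pos_part (- (b + d%:Z * g * m)) - pos_part (- b)) + r%:Z * g * m.
Proof.
move=> d0; rewrite /expo.
have -> : r%:Z * (b + d%:Z * g * m) = r%:Z * g * m * d%:Z + r%:Z * b by ring.
by rewrite divzMDl; [ring|lia].
Qed.

Lemma expo_dvd d r (g : int) : (0 < d)%N ->
  expo (d%:Z * g) d r = d%:Z * pos_part (- g) + r%:Z * g.
Proof.
move=> d0; rewrite /expo mulrCA mulKz; last by lia.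
by congr (_ + _); rewrite !pos_partE; do 2!case: ifP; nia.
Qed.

Lemma expo_zero_row d r : expo 0 d r = 0.
Proof. by rewrite /expo mulr0 div0z oppr0 pos_partE. Qed.

End Exponents.

Lemma expz_abs (F : fieldType) (x : F) (z : int) : 0 <= z -> x ^ z = x ^+ absz z.
Proof. by case: z. Qed.

Section ExchangePolynomial.
Variables (N M : nat) (d : 'I_N -> nat).
Implicit Types (S : seed M d) (k : 'I_N) (i : 'I_(N + M)).

Definition variables S : 'I_(N + M) -> ratfun N M :=
  fun i => match split i with inl a => cluster S a | inr j => stable_var N M j end.

Lemma variables_l S a : variables S (lshift M a) = cluster S a.
Proof. by rewrite /variables (unsplitK (inl a)). Qed.

Lemma variables_r S j : variables S (rshift N j) = stable_var N M j.
Proof. by rewrite /variables (unsplitK (inr j)). Qed.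

Definition string_expo S k (r : 'I_(d k).+1) i : nat :=
  match split i with inl _ => 0%N | inr j => string S k r j end.

Definition term_expo S k (r : 'I_(d k).+1) i : int :=
  expo (exch_mx S k i) (d k) r + (string_expo S r i)%:Z.

Definition term_mon S k (r : 'I_(d k).+1) : 'X_{1..N + M} :=
  [multinom absz (term_expo S r i) | i < N + M].

Definition exchange_mpoly S k : {mpoly int[N + M]} := sum_mon (term_mon S (k := k)).

Definition degrees_ok S := forall k, (0 < d k)%N /\
  forall j, exists g : int, exch_mx S k (lshift M j) = (d k)%:Z * g.

Lemma term_expo_ge0 S k (r : 'I_(d k).+1) i : degrees_ok S -> 0 <= term_expo S r i.
Proof.
move=> h; have [d0 _] := h k; have := ltn_ord r; rewrite ltnS => rd.
by rewrite /term_expo addr_ge0 // expo_ge0.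
Qed.

Lemma exchange_polyE S k : degrees_ok S ->
  exchange_poly S k = ev (variables S) (exchange_mpoly S k).
Proof.
move=> h; have [d0 dv] := h k; rewrite ev_sum_mon; apply: eq_bigr => r _.
have := ltn_ord r; rewrite ltnS => rd.
rewrite big_split_ord /=.
under [in RHS]eq_bigr => a _ do rewrite variables_l mnmE.
under [X in _ = _ * X]eq_bigr => j _ do rewrite variables_r mnmE.
have shuffle (R : comNzRingType) (m u v w x : R) :
  m * u * v * w * x = (u * w) * (m * v * x) by ring.
rewrite shuffle {shuffle}.
congr (_ * _).
  rewrite /u_gt /u_lt -!prodrXl big_mkcond [X in _ * X]big_mkcond -!big_split /=.
  apply: eq_bigr => a _; rewrite /term_expo /string_expo (unsplitK (inl a)) addr0.
  have [g gE] := dv a; rewrite gE expo_dvd // mulKz; last by lia.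
  case: (ltgtP g 0) => g0.
  - have -> : (0 < (d k)%:Z * g) = false by nia.
    have -> : (d k)%:Z * g < 0 by nia.
    rewrite mul1r -mulrN mulKz; last by lia.
    rewrite expz_abs -?exprM; last by lia.
    by congr (_ ^+ _); rewrite pos_partE; case: ifP; nia.
  - have -> : (0 < (d k)%:Z * g) by nia.
    have -> : ((d k)%:Z * g < 0) = false by nia.
    rewrite mulr1 expz_abs -?exprM; last by lia.
    by congr (_ ^+ _); rewrite pos_partE; case: ifP; nia.
  - by rewrite g0 !mulr0 !ltxx mulr1 ?expr0.
rewrite /mmap1 /v_gt /v_lt [X in _ * X * _]big_mkcond [X in _ * _ * X]big_mkcond -!big_split /=.
apply: eq_bigr => j _; rewrite /term_expo /string_expo (unsplitK (inr j)).
set c := exch_mx S k (rshift N j).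
have E0 := expo_ge0 c d0 rd.
have -> : absz (expo c (d k) r + (string S k r j)%:Z) = (string S k r j + absz (expo c (d k) r))%N by lia.
rewrite exprD -mulrA -expz_abs //; congr (_ * _).
case: (ltgtP c 0) => c0.
- rewrite mul1r -expo_rev // /expo opprK pos_partE; case: ifP => [|_]; first by lia.
  by rewrite add0r mulrN.
- rewrite mulr1 /expo pos_partE; case: ifP => [|_]; first by lia.
  by rewrite add0r.
- by rewrite c0 mulr1 /expo oppr0 pos_partE /= mulr0 div0z addr0 expr0z.
Qed.
End ExchangePolynomial.

(** * Mutation of seeds *)

(** The substitution [X k := P(X) / X k] is an involution [mu], because [P] does
    not involve the k-th variable.  If [p] vanishes at [mu X], then the numerator
    [q] of [p \o mu] vanishes at [X], so it is 0; then it also vanishes at [mu X],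
    which means that [p] vanishes at [mu (mu X) = X]. *)
Lemma birational_injective (F : fieldType) n (X : 'I_n -> F) k (P : {mpoly int[n]}) :
    (forall p, ev X p = 0 -> p = 0) -> (forall Z a, ev (setv Z k a) P = ev Z P :> F) ->
    P <> 0 ->
  forall p, ev (setv X k (ev X P / X k)) p = 0 -> p = 0.
Proof.
move=> Xinj Pk P0 p.
have X0 i : X i <> 0.
  by rewrite -evU => /Xinj e; have := indet_neq0 i; rewrite /indet e eqxx.
pose mu (Z : 'I_n -> F) := setv Z k (ev Z P / Z k).
have clear q : exists D q', forall Z, Z k <> 0 -> ev Z q' = Z k ^+ D * ev (mu Z) q.
  elim/ev_ind: q => [|q r [a [q' hq]] [b [r' hr]]|q r [a [q' hq]] [b [r' hr]]|i].
  - by exists 0%N, 1 => Z _; rewrite !rmorph1 mulr1.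
  - exists (a + b)%N, (indet k ^+ b * q' - indet k ^+ a * r') => Z Z0.
    rewrite !rmorphB !rmorphM !rmorphXn /= hq // hr // !evU exprD; ring.
  - exists (a + b)%N, (q' * r') => Z Z0.
    rewrite !rmorphM /= hq // hr // exprD; ring.
  - have [->|ik] := eqVneq i k.
      exists 1%N, P => Z /eqP Z0; rewrite evU /mu /setv eqxx expr1 mulrC divfK //.
    by exists 0%N, 'X_i => Z Z0; rewrite !evU /mu /setv (negPf ik) mul1r.
move=> E; have [D [q hq]] := clear p.
have q0 : q = 0 by apply: Xinj; rewrite hq // E mulr0.
have PX : ev X P != 0 by apply/eqP => /Xinj.
have muX : mu X k <> 0.
  apply/eqP; rewrite /mu /setv eqxx mulf_neq0 // invr_neq0 //; exact/eqP.
have := hq (mu X) muX; rewrite q0 rmorph0 => /esym/eqP; rewrite mulf_eq0.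
rewrite (negPf (expf_neq0 _ (introN eqP muX))) /= => /eqP e.
apply: Xinj; rewrite -[RHS]e; apply: eq_ev => i.
rewrite {1}/mu /setv; case: eqP => [->|ik]; last by rewrite /mu /setv (introF eqP ik).
have -> : ev (mu X) P = ev X P by rewrite /mu Pk.
by rewrite /mu /setv eqxx invf_div mulrC divfK.
Qed.

Lemma sg_pos_part (x y : int) : x * pos_part (Num.sg x * y) = pos_part (- x) * y + x * pos_part y.
Proof.
case: (ltgtP x 0) => x0; last by rewrite x0; ring.
- rewrite ltr0_sg // mulN1r [pos_part (- x)]pos_partE oppr_ge0 ltW //.
  by rewrite -{2}[y]pos_partN; ring.
- by rewrite gtr0_sg // mul1r [pos_part (- x)]pos_partE oppr_ge0 leNgt x0 mul0r add0r.
Qed.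

Lemma sg_pos_part_skew (u y : int) :
  u * pos_part (- Num.sg u * y) = - (y * pos_part (- Num.sg y * u)).
Proof.
have [->|u0] := eqVneq u 0; first by rewrite mul0r mulr0 [pos_part 0]pos_partE lexx mulr0 oppr0.
have [->|y0] := eqVneq y 0; first by rewrite mul0r mulr0 [pos_part 0]pos_partE lexx mulr0 oppr0.
have {}u0 : u < 0 \/ 0 < u by lia.
have {}y0 : y < 0 \/ 0 < y by lia.
case: u0 => u0; case: y0 => y0.
all: rewrite ?(ltr0_sg u0) ?(ltr0_sg y0) ?(gtr0_sg u0) ?(gtr0_sg y0).
all: rewrite !pos_partE; do 2?[case: ifP => ?]; nia.
Qed.

Section GoodSeeds.
Variables (N M : nat) (d : 'I_N -> nat).
Implicit Types (S : seed M d) (k : 'I_N) (i : 'I_(N + M)).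
Local Notation l := (lshift M).
Local Notation r := (@rshift N M).

(** The properties of seeds on which the proof relies, in a form that is visibly
    preserved by mutation.  The rank of a string matrix is expressed by its right
    inverse: a linear form on the isolated variables can take any prescribed
    values on the string, up to a common denominator [D]; in this way the size of
    the matrix, which depends on the set of isolated variables, disappears. *)
Record good S : Prop := Good {
  good_inj : forall p, ev (variables S) p = 0 -> p = 0;
  good_skew : exists D : 'I_N -> int, (forall a, 0 < D a) /\
    forall a b, D a * exch_mx S a (l b) = - (D b * exch_mx S b (l a));
  good_deg : degrees_ok S;
  good_ends : forall k, string S k ord0 = 0%MM /\ string S k ord_max = 0%MM;
  good_rank : forall v : 'I_N -> int,
    (forall i, \sum_a v a * exch_mx S a i = 0) -> forall a, v a = 0;
  good_string : forall k (c : nat -> int), exists (mu : 'I_M -> int) (D : int),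
    [/\ 0 < D, forall j, mu j <> 0 -> forall a, exch_mx S a (r j) = 0 &
     forall s : 'I_(d k).+1, (0 < s < d k)%N ->
       \sum_j mu j * (string S k s j)%:Z = D * c s] }.

(** The mutated row is the old one plus a multiple of a nonnegative part of the
    k-th row; this is the form in which monomials are substituted. *)
Lemma matrix_mutationE (B : 'M[int]_(N, N + M)) k a i : a != k -> i != l k ->
  matrix_mutation k B a i = B a i + B a (l k) * pos_part (Num.sg (B a (l k)) * B k i).
Proof.
move=> ak ik; rewrite mxE (negPf ak) (negPf ik) /=; congr (_ + _).
set x := B a (l k); set y := B k i; rewrite pos_partE.
have -> : `|x| * y + x * `|y| = (x * (if 0 <= Num.sg x * y then Num.sg x * y else 0)) * 2.
  case: (ltgtP x 0) => x0.
  - rewrite ltr0_sg // ltr0_norm // mulN1r oppr_ge0.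
    by case: (lerP y 0) => y0; [rewrite ler0_norm|rewrite gtr0_norm] => //; ring.
  - rewrite gtr0_sg // gtr0_norm // mul1r.
    by case: (lerP 0 y) => y0; [rewrite ger0_norm|rewrite ltr0_norm] => //; ring.
  - by rewrite x0 normr0 !mul0r.
by rewrite mulzK.
Qed.

Lemma matrix_mutationN (B : 'M[int]_(N, N + M)) k a i : (a == k) || (i == l k) ->
  matrix_mutation k B a i = - B a i.
Proof. by move=> h; rewrite mxE h. Qed.

Lemma variables_mutation S k :
  variables (mutation k S)
  =1 setv (variables S) (l k) (exchange_poly S k / cluster S k).
Proof.
move=> i; rewrite /setv -(splitK i); case: (split i) => a /=.
  by rewrite !variables_l /= (inj_eq (@lshift_inj _ _)).
by rewrite !variables_r eq_sym eq_lrshift.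
Qed.

Lemma good_diag S k : good S -> exch_mx S k (l k) = 0.
Proof. by move=> [_ [D [D0 h]] _ _ _ _]; have := h k k; have := D0 k; nia. Qed.

Lemma term_expo_diag S k (s : 'I_(d k).+1) : good S -> term_expo S s (l k) = 0.
Proof.
by move=> gS; rewrite /term_expo /string_expo (unsplitK (inl k)) good_diag // addr0 expo_zero_row.
Qed.

Lemma exchange_mpoly_setv (R : comNzRingType) S k (Z : 'I_(N + M) -> R) a : good S ->
  ev (setv Z (l k) a) (exchange_mpoly S k) = ev Z (exchange_mpoly S k).
Proof.
move=> gS; rewrite !ev_sum_mon; apply: eq_bigr => s _; apply: eq_bigr => i _.
by rewrite /setv; case: eqP => [->|//]; rewrite mnmE term_expo_diag.
Qed.

Lemma exchange_mpoly_neq0 S k : exchange_mpoly S k <> 0.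
Proof. exact: (@sum_mon_neq0 _ _ _ predT ord0). Qed.

Lemma variables_neq0 S i : good S -> variables S i != 0.
Proof.
move=> gS; apply/eqP; rewrite -evU => /(good_inj gS) e.
by have := indet_neq0 i; rewrite /indet e eqxx.
Qed.

Lemma exchange_poly_neq0 S k : good S -> exchange_poly S k != 0.
Proof.
move=> gS; rewrite exchange_polyE; last exact: good_deg.
by apply/eqP => /(good_inj gS); exact: exchange_mpoly_neq0.
Qed.

Lemma exchange_mpoly_mutation S k : degrees_ok S ->
  exchange_mpoly (mutation k S) k = exchange_mpoly S k.
Proof.
move=> h; have [d0 _] := h k; rewrite /exchange_mpoly /sum_mon.
rewrite [RHS](reindex_inj rev_ord_inj); apply: eq_bigr => s _; congr 'X_[_].
apply/mnmP => i; rewrite !mnmE; congr absz; rewrite /term_expo; congr (_ + _).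
  rewrite [exch_mx (mutation k S) k i]matrix_mutationN ?eqxx // -expo_rev ?leq_ord //.
  by rewrite opprK.
by rewrite /string_expo; case: (split i) => // j /=; rewrite eqxx.
Qed.

(** Algebraic independence is [birational_injective].  The rank is preserved since
    mutation acts by invertible row and column operations, and the string condition
    because a string is at most reversed and isolated columns remain zero. *)
Lemma good_mutation S k : good S -> good (mutation k S).
Proof.
move=> gS; have bkk := good_diag k gS; have [inj [D [D0 sk]] dg en rk st] := gS.
split.
- move=> p; rewrite (eq_ev _ (variables_mutation S k)) exchange_polyE //.
  rewrite -variables_l; apply: birational_injective => //.
    by move=> Z a; apply: exchange_mpoly_setv.
  exact: exchange_mpoly_neq0.
- exists D; split => // a b.
  have [->|ak] := eqVneq a k.
    by rewrite [exch_mx _ k _]matrix_mutationN ?eqxx // [exch_mx _ b _]matrix_mutationN ?eqxx ?orbT // !mulrN sk.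
  have [->|bk] := eqVneq b k.
    by rewrite [exch_mx _ k _]matrix_mutationN ?eqxx // [exch_mx _ a _]matrix_mutationN ?eqxx ?orbT // !mulrN sk.
  rewrite !matrix_mutationE ?(inj_eq (@lshift_inj _ _)) //.
  have := sk a b; have := sk a k; have := sk k b; have := D0 a; have := D0 b; have := D0 k.
  set x := exch_mx S a (l k); set y := exch_mx S k (l b).
  set u := exch_mx S k (l a); set v := exch_mx S b (l k).
  move=> k0 b0 a0 Ekb Eak Eab.
  have sgM (p q : int) : 0 < p -> Num.sg (p * q) = Num.sg q.
    by move=> p0; rewrite sgrM gtr0_sg // mul1r.
  have -> : Num.sg x = - Num.sg u by rewrite -(sgM _ _ a0) Eak sgrN sgM.
  have -> : Num.sg v = - Num.sg y by rewrite -(sgM _ y k0) Ekb sgrN sgM // opprK.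
  have key := sg_pos_part_skew u y.
  set p1 := pos_part _ in key *; set p2 := pos_part _ in key *.
  have E : D a * (x * p1) = - (D b * (v * p2)).
    rewrite mulrA Eak mulNr -mulrA key mulrN opprK [LHS]mulrA Ekb mulNr -mulrA; reflexivity.
  by rewrite !mulrDr E Eab opprD.
- move=> a; split; first by have [] := dg a.
  move=> b; have [->|ak] := eqVneq a k.
    have [g gE] := (dg k).2 b; exists (- g).
    by rewrite [LHS]matrix_mutationN ?eqxx // gE mulrN.
  have [g gE] := (dg a).2 b; have [g' gE'] := (dg a).2 k.
  have [->|bk] := eqVneq b k.
    by exists (- g'); rewrite [LHS]matrix_mutationN ?eqxx ?orbT // gE' mulrN.
  exists (g + g' * pos_part (Num.sg (exch_mx S a (l k)) * exch_mx S k (l b))).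
  by rewrite matrix_mutationE ?(inj_eq (@lshift_inj _ _)) // gE {1}gE' mulrDr mulrA.
- move=> a; have [e0 e1] := en a; rewrite /=; case: eqP => [e|//].
  have r0 : rev_ord (@ord0 (d a)) = ord_max by apply: val_inj; rewrite /= subn1.
  by have r1 : rev_ord (@ord_max (d a)) = ord0 by [rewrite -r0 rev_ordK]; rewrite r0 r1.
- move=> v hv.
  have col : \sum_a v a * exch_mx S a (l k) = 0.
    apply/eqP; rewrite -oppr_eq0 -sumrN; apply/eqP; rewrite -[RHS](hv (l k)).
    by apply: eq_bigr => a _; rewrite [exch_mx (mutation _ _) _ _]matrix_mutationN ?eqxx ?orbT // mulrN.
  (* row operations: v is transformed into a vector v' annihilating the
     original matrix *)
  pose c := \sum_(a | a != k) v a * pos_part (- exch_mx S a (l k)).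
  pose v' a := if a == k then c - v k else v a.
  have v'0 : forall a, v' a = 0.
    apply: rk => i; rewrite (bigD1 k) //= {1}/v' eqxx.
    rewrite (eq_bigr (fun a => v a * exch_mx S a i)); last first.
      by move=> a /negPf ak; rewrite /v' ak.
    have col' : \sum_(a | a != k) v a * exch_mx S a (l k) = 0.
      by rewrite -[RHS]col [RHS](bigD1 k) //= bkk mulr0 add0r.
    have [->|ik] := eqVneq i (l k); first by rewrite bkk mulr0 add0r.
    have := hv i; rewrite (bigD1 k) //= [exch_mx (mutation _ _) _ _]matrix_mutationN ?eqxx //.
    rewrite (eq_bigr (fun a => v a * exch_mx S a i
        + (v a * pos_part (- exch_mx S a (l k))) * exch_mx S k i
        + v a * exch_mx S a (l k) * pos_part (exch_mx S k i))); last first.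
      by move=> a ak; rewrite [exch_mx (mutation _ _) _ _]matrix_mutationE // sg_pos_part; ring.
    rewrite !big_split /= -!mulr_suml col' mul0r addr0 -/c => e.
    by rewrite -[RHS]e; ring.
  have vk a : a != k -> v a = 0 by move=> /negPf ak; have := v'0 a; rewrite /v' ak.
  move=> a; have [->|] := eqVneq a k; last exact: vk.
  have := v'0 k; rewrite /v' eqxx /c big1; first by move/eqP; rewrite sub0r oppr_eq0 => /eqP.
  by move=> b /vk ->; rewrite mul0r.
- move=> a c; have [mu [E [E0 hmu hs]]] := st a (fun s => if a == k then c (d a - s)%N else c s).
  exists mu, E; split => //.
    move=> j /hmu h b; have [->|bk] := eqVneq b k.
      by rewrite [LHS]matrix_mutationN ?eqxx // h oppr0.
    by rewrite matrix_mutationE ?h ?add0r ?h ?mulr0 ?mulr0 // eq_sym eq_lrshift.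
  move=> s sd /=; case: eqP hs => [ak|_] hs; last exact: hs.
  rewrite hs /=; last by have := ltn_ord s; lia.
  by congr (_ * c _); lia.
Qed.

Lemma mutationK S k : good S -> mutation k (mutation k S) = S.
Proof.
move=> gS; have bkk := good_diag k gS.
have eP : exchange_poly (mutation k S) k = exchange_poly S k.
  rewrite !exchange_polyE ?exchange_mpoly_mutation //; try exact: good_deg.
    rewrite (eq_ev _ (variables_mutation S k)); exact: exchange_mpoly_setv.
  by apply: good_deg; apply: good_mutation.
have x0 := variables_neq0 (l k) gS; rewrite variables_l in x0.
have P0 := exchange_poly_neq0 k gS.
case: S gS bkk eP x0 P0 => x B p gS bkk eP x0 P0; rewrite /mutation /=; congr Seed.
- apply: functional_extensionality => a; case: eqP => [->|//].
  move: eP; rewrite /mutation /= => ->; rewrite eqxx invf_div mulrC divfK //.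
- apply/matrixP => a i; rewrite /= in bkk.
  have [h|] := boolP ((a == k) || (i == l k)).
    by rewrite !matrix_mutationN // opprK.
  rewrite negb_or => /andP[ak ik]; rewrite matrix_mutationE // [matrix_mutation k B a (l k)]matrix_mutationN ?eqxx ?orbT //.
  rewrite [matrix_mutation k B k i]matrix_mutationN ?eqxx // matrix_mutationE //.
  by rewrite sgrN mulrNN; ring.
- apply: functional_extensionality_dep => a; apply: functional_extensionality => s.
  by case: eqP => // _; rewrite rev_ordK.
Qed.

End GoodSeeds.

(** * From the rank conditions to good seeds *)

Lemma intr_subring (F : fieldType) : is_subring (range (fun z : int => z%:~R : F)).
Proof.
split; first by exists 1.
- by move=> _ _ [a _ <-] [b _ <-]; exists (a - b) => //; rewrite intrB.
- by move=> _ _ [a _ <-] [b _ <-]; exists (a * b) => //; rewrite intrM.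
Qed.

Lemma stable_var_neq0 N M j : stable_var N M j != 0.
Proof.
rewrite tofrac_eq0; apply/eqP => /(congr1 (meval (fun=> 1))).
by rewrite mevalXU meval0; apply/eqP; rewrite oner_eq0.
Qed.

Lemma stable_laurent_subring N M : is_subring (stable_laurent_ring N M).
Proof. by apply: laurent_subring; [apply: intr_subring|apply: stable_var_neq0]. Qed.

Lemma ev_indet_rat_inj n (p : {mpoly int[n]}) :
  ev (fun i => 'X_i : {mpoly rat[n]}) p = 0 -> p = 0.
Proof.
have -> : ev (fun i => 'X_i : {mpoly rat[n]}) p = map_mpoly intr p.
  elim/ev_ind: p => [|p q IHp IHq|p q IHp IHq|i].
  - by rewrite !rmorph1.
  - by rewrite !rmorphB /= IHp IHq.
  - by rewrite !rmorphM /= IHp IHq.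
  - by rewrite evU map_mpolyX.
move/mpolyP => h; apply/mpolyP => m; have := h m.
by rewrite mcoeff_map_mpoly !mcoeff0 => /eqP; rewrite intr_eq0 => /eqP.
Qed.

Section FromSeed.
Variables (N M : nat) (d : 'I_N -> nat) (S : seed M d).
Hypothesis seedS : is_seed S.

(** A polynomial relation between all the variables is regrouped as a relation
    between the cluster variables with coefficients in the ring generated by the
    stable ones.  By independence of the cluster all these coefficients vanish, so
    the relation also holds at any other point over the same stable variables, in
    particular at the generators of the field. *)
Lemma seed_variables_inj p : ev (variables S) p = 0 -> p = 0.
Proof.
have [[tr _] _ _ _] := seedS; move=> E.
pose L := stable_laurent_ring N M; have sL : is_subring L := stable_laurent_subring N M.
pose X i : {mpoly (ratfun N M)[N]} :=
  match split i with inl a => 'X_a | inr j => (stable_var N M j)%:MP end.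
have G0 : ev X p = 0.
  apply: tr; last first.
    rewrite -[LHS]/(meval (cluster S) (ev X p)) rmorph_ev -[RHS]E; apply: eq_ev => i /=.
    by rewrite /X /variables; case: (split i) => a; rewrite ?mevalXU ?mevalC.
  have LK c : L c -> frac_field L c.
    by move=> Lc; exists c, 1; rewrite oner_neq0 divr1; split => //; apply: subring1.
  move=> m; apply: LK.
  have Ln (b : bool) : L b%:R by case: b; [apply: subring1|apply: subring0].
  move: m; apply: (@ev_closed _ _ (fun q : {mpoly (ratfun N M)[N]} => forall m, L q@_m)).
  - by move=> m; rewrite mcoeff1.
  - by move=> a b ha hb m; rewrite mcoeffB; apply: subringB.
  - by move=> a b ha hb m; rewrite mcoeffM; apply: subring_sum => // k _; apply: subringM.
  - move=> i m; rewrite /X; case: (split i) => a; first by rewrite mcoeffX.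
    rewrite mcoeffC; apply: subringM => //.
    exact: (laurent_var (stable_var N M) (intr_subring _) a).
apply: ev_indet_rat_inj; apply/eqP; rewrite -tofrac_eq0; apply/eqP.
have := congr1 (meval (fun a => FracField.tofrac 'X_(lshift M a) : ratfun N M)) G0.
rewrite rmorph_ev meval0 rmorph_ev => <-; apply: eq_ev => i /=.
rewrite /X -{1}(splitK i); case: (split i) => a /=; first by rewrite mevalXU.
by rewrite mevalC.
Qed.

Hypothesis full_rank : int_rank (exch_mx S) = N.
Hypothesis string_rank : forall i : 'I_N, d i <> 1%N ->
  int_rank (string_mx S i) = (d i).-1.

Lemma seed_rank (v : 'I_N -> int) :
  (forall i, \sum_a v a * exch_mx S a i = 0) -> forall a, v a = 0.
Proof.
move=> h a; pose w : 'rV[rat]_N := \row_a (v a)%:~R.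
have rf : row_free (map_mx (fun z : int => z%:~R : rat) (exch_mx S)).
  by rewrite /row_free -[X in _ == X]full_rank.
have /(row_free_inj rf) /rowP /(_ a) : w *m map_mx (fun z : int => z%:~R : rat) (exch_mx S)
   = 0 *m map_mx (fun z : int => z%:~R : rat) (exch_mx S).
  rewrite mul0mx; apply/rowP => i; rewrite !mxE -[RHS](rmorph0 (intmul 1)) -(h i).
  by rewrite rmorph_sum; apply: eq_bigr => b _; rewrite !mxE rmorphM.
by rewrite !mxE => /eqP; rewrite intr_eq0 => /eqP.
Qed.

Lemma rat_clear (I : finType) (x : I -> rat) :
  exists (D : int) (y : I -> int), 0 < D /\ forall i, D%:~R * x i = (y i)%:~R.
Proof.
exists (\prod_i denq (x i)), (fun i => numq (x i) * \prod_(j | j != i) denq (x j)).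
split; first by apply: prodr_gt0 => i _; apply: denq_gt0.
move=> i; rewrite (bigD1 i) //= !intrM numqE mulrAC; congr (_ * _); exact: mulrC.
Qed.

Lemma seed_string k (c : nat -> int) : exists (mu : 'I_M -> int) (D : int),
    [/\ 0 < D, forall j, mu j <> 0 -> forall a, exch_mx S a (rshift N j) = 0 &
     forall s : 'I_(d k).+1, (0 < s < d k)%N ->
       \sum_j mu j * (string S k s j)%:Z = D * c s].
Proof.
have [d1|/eqP d1] := eqVneq (d k) 1%N.
  exists (fun=> 0), 1; split => // s /andP[]; move: d1; lia.
pose A := map_mx (fun z : int => z%:~R : rat) (string_mx S k).
have /row_freeP[B AB] : row_free A by rewrite /row_free -[X in _ == X](string_rank d1).
pose t : 'cV[rat]_(d k).-1 := \col_r (c r.+1)%:~R.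
have [D [y [D0 yE]]] := rat_clear (fun l => (B *m t) l 0).
pose mu j := if [pick l | enum_val l == j] is Some l then y l else 0.
have muE l : mu (enum_val l) = y l.
  rewrite /mu; case: pickP => [l' /eqP /enum_val_inj -> //|/(_ l)].
  by rewrite eqxx.
have mu0 j : j \notin isolated (exch_mx S) -> mu j = 0.
  by move=> h; rewrite /mu; case: pickP => // l /eqP e; rewrite -e enum_valP in h.
exists mu, D; split => //.
  move=> j muj a; have : j \in isolated (exch_mx S).
    by apply/negPn/negP => /mu0.
  by rewrite inE => /forallP /(_ a) /eqP.
move=> s /andP[s0 sd]; have sr : (s.-1 < (d k).-1)%N by lia.
apply: (@intr_inj rat).
have := congr1 (fun C => (C *m t) (Ordinal sr) 0) AB.
rewrite mul1mx -mulmxA [RHS]mxE /= prednK // => E.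
rewrite rmorphM /= -E mxE mulr_sumr rmorph_sum /=.
rewrite (bigID (mem (isolated (exch_mx S)))) /= [X in _ + X]big1 ?addr0; last first.
  by move=> j /mu0 ->; rewrite mul0r.
rewrite big_enum_val; apply: eq_bigr => l _.
rewrite muE intrM -yE -mulrA; congr (_ * _).
by rewrite [in RHS]mulrC !mxE /= prednK // inord_val.
Qed.

Lemma seed_good : good S.
Proof.
have [_ [D [D0 sk]] dg en] := seedS; split.
- exact: seed_variables_inj.
- exists (fun a => D 0 a); split => // a b.
  by move: sk; rewrite !mul_diag_mx => /matrixP /(_ b a); rewrite !mxE.
- move=> k; have [d0 dv] := dg k; split => // j.
  have : (d k %| `|exch_mx S k (lshift M j)|)%N.
    by apply: dvdn_trans dv _; apply: (biggcdn_inf j).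
  by rewrite -[d k]/(`|(d k)%:Z|)%N => /dvdzP[g ->]; exists g; rewrite mulrC.
- exact: en.
- exact: seed_rank.
- exact: seed_string.
Qed.
End FromSeed.

(** * Coprimality of exchange polynomials *)

Section Coprimality.
Variables (N M : nat) (d : 'I_N -> nat) (S : seed M d).
Hypothesis gS : good S.
Local Notation l := (lshift M).
Local Notation r := (@rshift N M).
Implicit Types (j k : 'I_N) (i : 'I_(N + M)).

Let dg := good_deg gS.

Lemma term_mon_end0 k i : term_mon S (@ord0 (d k)) i = absz (pos_part (- exch_mx S k i)).
Proof.
rewrite mnmE /term_expo expo0 /string_expo.
by case: (split i) => [_|m]; rewrite ?(good_ends gS k).1 ?mnm0E addr0.
Qed.

Lemma term_mon_end1 k i : term_mon S (@ord_max (d k)) i = absz (pos_part (exch_mx S k i)).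
Proof.
have [d0 _] := dg k; rewrite mnmE /term_expo expo_full // /string_expo.
by case: (split i) => [_|m]; rewrite ?(good_ends gS k).2 ?mnm0E addr0.
Qed.

Lemma term_mon_prim k i : exists s : 'I_(d k).+1, term_mon S s i = 0%N.
Proof.
have [b0|b0] := leP 0 (exch_mx S k i).
  by exists ord0; rewrite term_mon_end0 pos_partE; case: ifP => //; lia.
by exists ord_max; rewrite term_mon_end1 pos_partE; case: ifP => //; lia.
Qed.

(** The weights that separate two rows are supported at two columns where the
    rows have a nonzero minor. *)
Lemma rows_minor j k : j != k -> exists i1 i2,
  0 < exch_mx S j i1 * exch_mx S k i2 - exch_mx S j i2 * exch_mx S k i1.
Proof.
move=> jk; pose mn i1 i2 := exch_mx S j i1 * exch_mx S k i2 - exch_mx S j i2 * exch_mx S k i1.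
have [/existsP[i1 /existsP[i2 h]]|h] := boolP [exists i1, exists i2, mn i1 i2 != 0].
  case: (ltgtP 0 (mn i1 i2)) => h'; first by exists i1, i2.
    by exists i2, i1; rewrite -/(mn _ _); rewrite /mn in h' *; lia.
  by rewrite -h' eqxx in h.
have {}h i1 i2 : mn i1 i2 = 0.
  by apply/eqP; move: h; rewrite negb_exists => /forallP/(_ i1); rewrite negb_exists => /forallP/(_ i2)/negPn.
have two (a b : int) i : \sum_c (if c == j then a else if c == k then b else 0) * exch_mx S c i
   = a * exch_mx S j i + b * exch_mx S k i.
  have kj : k != j by rewrite eq_sym.
  rewrite (bigD1 j) //= eqxx (bigD1 k) //= (negPf kj) eqxx big1 ?addr0 //.
  by move=> c /andP[/negPf -> /negPf ->]; rewrite mul0r.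
have bk0 i : exch_mx S k i = 0.
  have := @good_rank _ _ _ _ gS (fun c => if c == j then exch_mx S k i else
     if c == k then - exch_mx S j i else 0) _ j.
  rewrite eqxx; apply => i'; rewrite two mulNr -(h i' i) /mn; ring.
have := @good_rank _ _ _ _ gS (fun c => if c == j then 0 else if c == k then 1 else 0) _ k.
have kj : k != j by rewrite eq_sym.
rewrite (negPf kj) eqxx => e; suff: 1 = 0 :> int by [].
by apply: e => i; rewrite two bk0 mulr0 mul0r.
Qed.

(** The weights [lam0] vanish on row k and are positive on row j.  They live on
    non-isolated variables, so adding suitable weights [mu] of the isolated
    variables equalizes the inner monomials of the j-th exchange polynomial with
    its first one, without changing the first and the last ones. *)
Lemma exchange_regular j k (g h : {mpoly int[N + M]}) : j != k ->
  exchange_mpoly S k * h = exchange_mpoly S j * g -> exists q, h = exchange_mpoly S j * q.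
Proof.
move=> jk E; have [i1 [i2 mn]] := rows_minor jk.
pose iso i := match split i with inl _ => false
  | inr m => [forall a, exch_mx S a (r m) == 0] end.
have isoP i : iso i -> forall a, exch_mx S a i = 0.
  rewrite /iso -{2}(splitK i); case: (split i) => // m /forallP h' a /=; exact/eqP.
pose lam0 i : int := (if i == i1 then exch_mx S k i2 else 0) - (if i == i2 then exch_mx S k i1 else 0).
have lam0E (f : 'I_(N+M) -> int) :
  \sum_i lam0 i * f i = exch_mx S k i2 * f i1 - exch_mx S k i1 * f i2.
  under eq_bigr => i _ do rewrite /lam0 mulrBl.
  rewrite sumrB; congr (_ - _).
    by rewrite (bigD1 i1) //= eqxx big1 ?addr0 // => i /negPf ->; rewrite mul0r.
  by rewrite (bigD1 i2) //= eqxx big1 ?addr0 // => i /negPf ->; rewrite mul0r.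
pose wt0 (m : 'X_{1..N + M}) : int := weight lam0 m.
have [mu [D [D0 hmu hs]]] := good_string gS j
  (fun s => wt0 (term_mon S (@ord0 (d j))) - wt0 (term_mon S (inord s : 'I_(d j).+1))).
pose lam i : int := D * lam0 i + match split i with inl _ => 0 | inr m => mu m end.
have wtE a (s : 'I_(d a).+1) : weight lam (term_mon S s)
    = D * wt0 (term_mon S s) + \sum_m mu m * (string S a s m)%:Z.
  rewrite /weight; under eq_bigr => i _ do rewrite /lam mulrDl -mulrA.
  rewrite big_split /= -mulr_sumr; congr (_ + _).
  rewrite big_split_ord /= big1 ?add0r; last by move=> b _; rewrite (unsplitK (inl b)) mul0r.
  apply: eq_bigr => m _; rewrite (unsplitK (inr m)).
  have [->|/eqP m0] := eqVneq (mu m) 0; first by rewrite !mul0r.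
  congr (_ * _); rewrite mnmE /term_expo (hmu _ m0) /string_expo (unsplitK (inr m)) expo_zero_row.
  by rewrite add0r.
have ends a : (\sum_m mu m * (string S a ord0 m)%:Z = 0) /\
              (\sum_m mu m * (string S a ord_max m)%:Z = 0).
  have [-> ->] := good_ends gS a.
  by split; apply: big1 => m _; rewrite mnm0E mulr0.
have wt01 a : wt0 (term_mon S (@ord_max (d a)))
    = wt0 (term_mon S (@ord0 (d a))) + \sum_i lam0 i * exch_mx S a i.
  rewrite /wt0 /weight -big_split; apply: eq_bigr => i _ /=.
  rewrite term_mon_end0 term_mon_end1 -mulrDr; congr (_ * _).
  by rewrite !gez0_abs ?pos_part_ge0 // -[X in _ + X](pos_partN (exch_mx S a i)); ring.
have iso_ends a : no_iso iso (term_mon S (@ord0 (d a))) /\ no_iso iso (term_mon S (@ord_max (d a))).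
  split; apply/forallP => i; apply/implyP => /isoP/(_ a) e.
    by rewrite term_mon_end0 e.
  by rewrite term_mon_end1 e.
apply: (@regular_sum_mon _ iso lam (d j) (d k) (term_mon S (k := j)) (term_mon S (k := k)) g h) => //.
- by have [] := dg j.
- exact: term_mon_prim.
- exact: (iso_ends j).1.
- exact: (iso_ends j).2.
- move=> s sd; have [s0|s0] := posnP s.
    by have -> : s = ord0 by apply: val_inj.
  rewrite !wtE (ends j).1 hs ?s0 ?sd // inord_val; ring.
- rewrite !wtE (ends j).1 (ends j).2 wt01 lam0E; nia.
- exact: (iso_ends k).1.
- move=> s ns; have [s0|s0] := posnP s.
    by have -> : s = ord0 by apply: val_inj.
  have [sd|sd] := ltnP s (d k); last first.
    have -> : s = ord_max by apply: val_inj; apply/eqP; rewrite /= eqn_leq leq_ord.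
    by rewrite !wtE (ends k).1 (ends k).2 wt01 lam0E; ring.
  (* an inner monomial of the k-th string involves some isolated variable, since
     some linear form on these variables does not vanish on it *)
  exfalso; have [nu [D' [D'0 hnu hs']]] := good_string gS k (fun=> 1).
  have := hs' s; rewrite s0 sd => /(_ isT); rewrite big1 ?mulr1; first by lia.
  move=> m _; have [->|/eqP m0] := eqVneq (nu m) 0; first by rewrite mul0r.
  have im : iso (r m) by rewrite /iso (unsplitK (inr m)); apply/forallP => a; rewrite (hnu _ m0).
  move/forallP: ns => /(_ (r m)); rewrite im /= mnmE /term_expo (hnu _ m0) /string_expo (unsplitK (inr m)).
  rewrite expo_zero_row add0r absz_nat => /eqP ->.
  by rewrite mulr0.
Qed.
End Coprimality.

(** * Laurent polynomials in all the variables but one *)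

Section Localized.
Variables (F : fieldType) (N M : nat) (X : 'I_(N + M) -> F) (j : 'I_N).
Local Notation l := (lshift M).
Local Notation r := (@rshift N M).
Hypothesis X_inj : forall p, ev X p = 0 -> p = 0.
Variable Ahat : set F.
Hypothesis sA : is_subring Ahat.
Hypothesis A_sub : forall p : {mpoly int[M]}, Ahat (ev (X \o r) p).
Hypothesis A_loc : forall f, Ahat f -> exists p q : {mpoly int[M]},
  [/\ ev (X \o r) q <> 0, Ahat (ev (X \o r) q)^-1 & f = ev (X \o r) p / ev (X \o r) q].
Implicit Types (i : 'I_(N + M)) (p q : {mpoly int[N + M]}).

Let t := X (l j).

(** Replacing the j-th variable by 1 instead of removing it keeps the index set,
    so that [laurent Ahat rest] is the ring of Laurent polynomials in the other
    cluster variables. *)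
Definition rest (a : 'I_N) : F := if a == j then 1 else X (l a).
Let Y := laurent Ahat rest.
Let Xr := setv X (l j) 1.
Let sigma := setv (@indet (N + M)) (l j) 1.

Lemma X_neq0 i : X i != 0.
Proof.
apply/eqP; rewrite -evU => /X_inj e.
by have := indet_neq0 i; rewrite /indet e eqxx.
Qed.

Lemma rest_neq0 a : rest a != 0.
Proof. by rewrite /rest; case: ifP => _; rewrite ?oner_neq0 ?X_neq0. Qed.

Lemma rest_subring : is_subring Y.
Proof. by apply: laurent_subring => //; apply: rest_neq0. Qed.
Let sY := rest_subring.

Lemma stable_in_A m : Ahat (X (r m)).
Proof. by have := A_sub 'X_m; rewrite evU. Qed.

Lemma Xr_in_Y i : Y (Xr i).
Proof.
rewrite /Xr /setv -(splitK i); case: (split i) => a /=.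
  rewrite (inj_eq (@lshift_inj _ _)).
  case: ifP => aj; first exact: subring1.
  by have := laurent_var rest sA a; rewrite /rest aj.
rewrite eq_sym eq_lrshift; apply: laurent_coef => //; exact: stable_in_A.
Qed.

Lemma ev_Xr_in_Y p : Y (ev Xr p).
Proof. by apply: subring_ev => // i; apply: Xr_in_Y. Qed.

Lemma ev_Xr p : ev Xr p = ev X (ev sigma p).
Proof.
rewrite rmorph_ev; apply: eq_ev => i; rewrite /= /Xr /sigma /setv.
by case: ifP => _; rewrite ?rmorph1 // /indet evU.
Qed.

Lemma ev_sigmaK p : ev sigma (ev sigma p) = ev sigma p.
Proof.
rewrite rmorph_ev; apply: eq_ev => i; rewrite /= /sigma /setv.
by case: ifP => ij; rewrite ?rmorph1 // evU ij.
Qed.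

Definition cleared w p (c : F) := [/\ w <> 0, Y w^-1 & w * c = ev Xr p].

Lemma cleared_frac a b w p : a = ev Xr p -> b = w -> b <> 0 -> Y b^-1 ->
  cleared w p (a / b).
Proof.
by move=> aE <- b0 Yb; split => //; rewrite mulrC divfK //; apply/eqP.
Qed.

(** This is where the ground ring being a localization matters: up to units of
    [Y], its elements are values of integer polynomials. *)
Lemma clear_denominators c : Y c -> exists q p, cleared (ev Xr q) p c.
Proof.
apply: (@laurent_min _ _ _ _ (fun c => exists q p, cleared (ev Xr q) p c)%classic).
- split.
  + by exists 1, 1; split; rewrite ?rmorph1 ?mulr1 ?invr1; [apply/eqP/oner_neq0|apply: subring1|].
  + move=> a b [w [p [/eqP w0 Yw wE]]] [v [q [/eqP v0 Yv vE]]].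
    exists (w * v), (v * p - w * q); split.
    * by apply/eqP; rewrite rmorphM mulf_neq0.
    * by rewrite rmorphM invfM; apply: subringM.
    * rewrite rmorphB !rmorphM /= -wE -vE; ring.
  + move=> a b [w [p [/eqP w0 Yw wE]]] [v [q [/eqP v0 Yv vE]]].
    exists (w * v), (p * q); split.
    * by apply/eqP; rewrite rmorphM mulf_neq0.
    * by rewrite rmorphM invfM; apply: subringM.
    * rewrite !rmorphM /= -wE -vE; ring.
- move=> f /A_loc [pa [pb [b0 Ab ->]]].
  have lift (pc : {mpoly int[M]}) : ev (X \o r) pc = ev Xr (ev (fun m => indet (r m)) pc).
    rewrite rmorph_ev; apply: eq_ev => m /=.
    by rewrite evU /Xr /setv eq_sym eq_lrshift.
  exists (ev (fun m => indet (r m)) pb), (ev (fun m => indet (r m)) pa).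
  exact: (cleared_frac (lift pa) (lift pb) b0 (laurent_coef _ Ab)).
- move=> a; exists 1, (if a == j then 1 else indet (l a)); split.
  + by rewrite rmorph1; apply/eqP/oner_neq0.
  + by rewrite rmorph1 invr1; apply: subring1.
  + rewrite rmorph1 mul1r /rest; case: ifP => aj; rewrite ?rmorph1 // evU /Xr /setv.
    by rewrite (inj_eq (@lshift_inj _ _)) aj.
- move=> a; exists (if a == j then 1 else indet (l a)), 1.
  have -> : ev Xr (if a == j then 1 else indet (l a)) = rest a.
    rewrite /rest; case: ifP => aj; rewrite ?rmorph1 // evU /Xr /setv.
    by rewrite (inj_eq (@lshift_inj _ _)) aj.
  split; [exact/eqP/rest_neq0|exact: laurent_varV|].
  by rewrite rmorph1 mulfV // rest_neq0.
Qed.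

(** After clearing denominators this is an algebraic relation between the variables;
    it is trivial, and it can be read as a polynomial in the j-th indeterminate. *)
Lemma t_free (p : {poly F}) : (forall i : nat, Y p`_i) -> p.[t] = 0 -> p = 0.
Proof.
move=> Yp E.
have [w [w0 [c hc]]] : exists w : F, w <> 0 /\ exists c : nat -> {mpoly int[N + M]},
    forall i : 'I_(size p), w * p`_i = ev Xr (c i).
  have clear n : exists w : {mpoly int[N + M]}, ev Xr w <> 0 /\ exists c : nat -> {mpoly int[N + M]},
    forall i : nat, (i < n)%N -> ev Xr w * p`_i = ev Xr (c i).
    elim: n => [|n [w [/eqP w0 [c hc]]]].
      by exists 1; split; [rewrite rmorph1; apply/eqP/oner_neq0|exists (fun=> 0)].
    have [v [q [/eqP v0 _ vE]]] := clear_denominators (Yp n).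
    exists (w * v); split; first by apply/eqP; rewrite rmorphM mulf_neq0.
    exists (fun i : nat => if i == n then w * q else v * c i) => i; rewrite ltnS leq_eqVlt.
    case: eqP => [-> _|_ /= h]; rewrite !rmorphM /=; first by rewrite -vE mulrA.
    by rewrite -hc // mulrA [ev Xr v * _]mulrC.
  have [w [w0 [c hc]]] := clear (size p).
  by exists (ev Xr w); split => //; exists c => i; apply: hc.
pose G := \sum_(i < size p) ev sigma (c i) * indet (l j) ^+ i.
have G0 : G = 0.
  apply: X_inj; rewrite raddf_sum /=.
  transitivity (w * p.[t]); last by rewrite E mulr0.
  rewrite horner_coef mulr_sumr; apply: eq_bigr => i _.
  by rewrite rmorphM rmorphXn /= evU -ev_Xr -hc mulrA.
pose rho := setv (fun i => (indet i)%:P) (l j) 'X.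
have rs q : ev rho (ev sigma q) = (ev sigma q)%:P.
  rewrite rmorph_ev [RHS]rmorph_ev; apply: eq_ev => i /=; rewrite /sigma /setv.
  by case: (eqVneq i (l j)) => [_|h]; rewrite ?rmorph1 // evU /rho /setv (negPf h).
have R : \poly_(i < size p) ev sigma (c i) = 0.
  rewrite poly_def -[RHS](rmorph0 (ev rho)) -G0 raddf_sum /=; apply: eq_bigr => i _.
  by rewrite rmorphM rmorphXn /= rs evU /rho /setv eqxx mul_polyC.
apply/polyP => i; rewrite coef0; have [ip|/(nth_default 0) //] := ltnP i (size p).
have /eqP := hc (Ordinal ip); rewrite ev_Xr /=.
have := congr1 (fun q : {poly {mpoly int[N + M]}} => q`_i) R.
rewrite coef_poly ip coef0 => ->; rewrite rmorph0 mulf_eq0 (negPf (introN eqP w0)) /=.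
by move/eqP.
Qed.

Variable Pm : {mpoly int[N + M]}.
Hypothesis sigma_P : ev sigma Pm = Pm.
Let P := ev X Pm.

Lemma P_in_Y : Y P.
Proof. by rewrite /P -sigma_P -ev_Xr; apply: ev_Xr_in_Y. Qed.

Lemma regular_unit u : u != 0 -> Y u^-1 -> regular_mod Y P u.
Proof.
move=> u0 Yu c Yc [e Ye E]; exists (e * u^-1); first exact: subringM.
by rewrite mulrA -E mulrC mulKf.
Qed.

Lemma regularM u v : Y v -> regular_mod Y P u -> regular_mod Y P v ->
  regular_mod Y P (u * v).
Proof.
by move=> Yv ru rv c Yc; rewrite -mulrA => /ru h; apply: rv => //; apply: h; apply: subringM.
Qed.

(** Regularity in [Y] reduces to integer polynomials.  The specialization [sigma] of
    the j-th indeterminate to 1 turns identities between elements of [Y] into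
    identities between polynomials that do not involve this indeterminate. *)
Lemma regular_of_mpoly G : ev sigma G = G ->
  (forall c h, G * c = Pm * h ->
     exists h', c = Pm * h') ->
  regular_mod Y P (ev X G).
Proof.
move=> sG hG c Yc [h Yh E]; rewrite expr1 in E.
have [w [p [/eqP w0 Yw wE]]] := clear_denominators Yc.
have [v [q [/eqP v0 Yv vE]]] := clear_denominators Yh.
have [A [sA' hA]] : exists A, ev sigma A = A /\ ev X A = ev Xr p * ev Xr v.
  by exists (ev sigma (p * v)); split; [apply: ev_sigmaK|rewrite -ev_Xr rmorphM].
have [B hB] : exists B, ev X B = ev Xr q * ev Xr w.
  by exists (ev sigma (q * w)); rewrite -ev_Xr rmorphM.
have [e eE] : exists e, A = Pm * e.
  apply: (hG _ B); apply/eqP; rewrite -subr_eq0; apply/eqP; apply: X_inj.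
  rewrite rmorphB !rmorphM /= hA hB.
  move: E wE vE; rewrite -/P; move: (ev Xr p) (ev Xr q) (ev Xr w) (ev Xr v) (ev X G).
  move=> p' q' w' v' G' E <- <-.
  have -> : G' * (w' * c * v') = (G' * c) * (w' * v') by ring.
  rewrite E; ring.
have e' : ev Xr p * ev Xr v = P * ev Xr e.
  by rewrite -hA -sA' eE rmorphM /= sigma_P rmorphM /= -ev_Xr.
move: w0 v0 Yw Yv wE e' (ev_Xr_in_Y e).
move: (ev Xr p) (ev Xr w) (ev Xr v) (ev Xr e) => p' w' v' f w0 v0 Yw Yv wE e' Yf.
exists (f * w'^-1 * v'^-1).
  by apply: subringM => //; apply: subringM.
rewrite expr1 !mulrA -e' -wE -!mulrA (mulrCA v') mulfV // mulr1.
by rewrite mulrCA mulfV // mulr1.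
Qed.

Hypothesis P_prim : forall i, ev (setv (@indet (N + M)) i 0) Pm <> 0.

Lemma regular_stable m : regular_mod Y P (X (r m)).
Proof.
rewrite -(evU X); apply: regular_of_mpoly.
  by rewrite evU /sigma /setv eq_sym eq_lrshift.
by move=> c h; apply: indet_dvd_cancel.
Qed.

Lemma regular_monomial (e : 'I_(N + M) -> int) :
    e (l j) = 0 -> (forall m, 0 <= e (r m)) ->
  Y (\prod_i X i ^ e i) /\ regular_mod Y P (\prod_i X i ^ e i).
Proof.
move=> ej em.
have one : regular_mod Y P 1 by apply: regular_unit; rewrite ?oner_neq0 // invr1; apply: subring1.
apply: (big_ind (fun u => Y u /\ regular_mod Y P u)).
- by split => //; apply: subring1.
- by move=> u v [Yu ru] [Yv rv]; split; [apply: subringM|apply: regularM].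
- move=> i _; rewrite -(splitK i); case: (split i) => a /=.
    have [->|aj] := eqVneq a j; first by rewrite ej expr0z; split => //; apply: subring1.
    have Yz z : Y (X (l a) ^ z).
      by have := laurent_varz rest sA a z; rewrite /rest (negPf aj).
    split=> //; apply: regular_unit; first by rewrite expfz_neq0 // X_neq0.
    by rewrite invr_expz.
  have := em a; case: (e (r a)) => // k _.
  elim: k => [|k [Yk rk]]; first by split => //; apply: subring1.
  have Ys : Y (X (r a)) by apply: laurent_coef => //; apply: stable_in_A.
  by rewrite exprSz; split; [apply: subringM|apply: regularM => //; apply: regular_stable].
Qed.
End Localized.

(** * Exchange polynomials at t = 0 *)

Lemma prod_expzD (F : fieldType) (I : finType) (x : I -> F) (a b : I -> int) :
  (forall i, x i != 0) ->
  (\prod_i x i ^ a i) * (\prod_i x i ^ b i) = \prod_i x i ^ (a i + b i).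
Proof. by move=> x0; rewrite -big_split; apply: eq_bigr => i _; rewrite expfzDr. Qed.

Section Initial.
Variables (N M : nat) (d : 'I_N -> nat) (S : seed M d) (j k : 'I_N).
Local Notation l := (lshift M).
Local Notation r := (@rshift N M).
Implicit Types (i : 'I_(N + M)).
Let beta : int := exch_mx S j (l k).
(** At t = 0 only one end term of the k-th exchange polynomial survives; these are
    the exponents of this monomial.  When [beta = 0] nothing is substituted, and the
    definition gives 0. *)
Definition mon_expo i : int := pos_part (Num.sg beta * exch_mx S k i).
(** The monomial by which the j-th exchange polynomials of the two seeds differ
    at t = 0. *)
Definition unit_expo i : int :=
  if i == l k then - `|beta| else mon_expo i * pos_part beta
   + (pos_part (- (exch_mx S j i + beta * mon_expo i)) - pos_part (- exch_mx S j i)).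

Lemma mon_expo_ge0 i : 0 <= mon_expo i.
Proof. exact: pos_part_ge0. Qed.

Lemma unit_expo_ge0 m : 0 <= unit_expo (r m).
Proof.
rewrite /unit_expo eq_sym eq_lrshift; have := mon_expo_ge0 (r m).
set e := mon_expo _; set b := exch_mx _ _ _ => e0.
rewrite ![pos_part _]pos_partE; have [b0|b0] := leP 0 beta; do 2?case: ifP; nia.
Qed.

Hypothesis gS : good S.
Hypothesis jk : j != k.
Let dg := good_deg gS.

(** Skew-symmetrizability: [b_jk] and [b_kj] vanish together and otherwise have
    opposite signs. *)
Lemma skew_sign : exch_mx S k (l j) = 0 /\ beta = 0 \/
  exch_mx S k (l j) < 0 /\ 0 < beta \/ 0 < exch_mx S k (l j) /\ beta < 0.
Proof.
have [D [D0 sk]] := good_skew gS; have := sk j k; have := D0 j; have := D0 k.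
rewrite -/beta => a b h; case: (ltgtP beta 0) => c.
- by right; right; split => //; nia.
- by right; left; split => //; nia.
- by left; split => //; nia.
Qed.

Lemma mon_expo_j : mon_expo (l j) = 0.
Proof.
rewrite /mon_expo pos_partE; case: skew_sign => [[-> ->]|[[a b]|[a b]]].
- by rewrite mulr0.
- by rewrite gtr0_sg // mul1r; case: ifP => //; lia.
- by rewrite ltr0_sg // mulN1r; case: ifP => //; lia.
Qed.

Lemma unit_expo_j : unit_expo (l j) = 0.
Proof.
by rewrite /unit_expo (inj_eq (@lshift_inj _ _)) (negPf jk) mon_expo_j good_diag // mulr0 mul0r.
Qed.

Variables (F : fieldType) (X : 'I_(N + M) -> F).
Hypothesis X_neq0 : forall i, X i != 0.
Let X0 : 'I_(N + M) -> F := setv X (l j) 0.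

Lemma exchange_at0 : beta <> 0 ->
  ev X0 (exchange_mpoly S k) = \prod_i X i ^ mon_expo i.
Proof.
move=> b0; have [d0 dv] := dg k; have [g gE] := dv j.
pose s0 : 'I_(d k).+1 := if 0 < beta then ord_max else ord0.
have s0E i : term_mon S s0 i = absz (mon_expo i).
  rewrite /s0 /mon_expo; case: (ltgtP beta 0) b0 => // c _.
    by rewrite term_mon_end0 // ltr0_sg // mulN1r.
  by rewrite term_mon_end1 // gtr0_sg // mul1r.
have jE (s : 'I_(d k).+1) : s != s0 -> term_mon S s (l j) != 0%N.
  move=> ss; rewrite mnmE /term_expo /string_expo (unsplitK (inl j)) gE expo_dvd //.
  have sd := leq_ord s.
  have {}ss : (s : nat) <> if 0 < beta then d k else 0%N.
    by move=> e; case/eqP: ss; apply: val_inj; rewrite /= e /s0; case: ifP.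
  have [[a b]|[[a b]|[a b]]] := skew_sign; rewrite gE in a.
  - by [].
  - rewrite b /= in ss; have g0 : g < 0 by nia.
    rewrite pos_partE oppr_ge0 ltW // addr0.
    have -> : (d k)%:Z * - g + s%:Z * g = ((d k)%:Z - s%:Z) * - g by ring.
    by rewrite absz_eq0 mulf_neq0 //; lia.
  - rewrite ltNge ltW //= in ss; have g0 : 0 < g by nia.
    rewrite pos_partE oppr_ge0 leNgt g0 /= mulr0 add0r addr0.
    by rewrite absz_eq0 mulf_neq0 //; lia.
rewrite ev_sum_mon (bigD1 s0) //= [X in _ + X]big1 ?addr0; last first.
  by move=> s /jE h; rewrite (bigD1 (l j)) //= /X0 /setv eqxx expr0n (negPf h) mul0r.
apply: eq_bigr => i _; rewrite s0E /X0 /setv; case: eqP => [->|_].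
  by rewrite mon_expo_j expr0 expr0z.
by rewrite -expz_abs // mon_expo_ge0.
Qed.

Let Z : 'I_(N + M) -> F := setv X0 (l k) (ev X0 (exchange_mpoly S k) / X (l k)).

(** The r-th terms on the two sides correspond.  The k-th variable of the mutated
    seed is a monomial at t = 0; it is raised to a power which is affine in [r], and
    the linear part cancels the change of the j-th row under mutation. *)
Lemma exchange_initial :
  ev Z (exchange_mpoly (mutation k S) j)
  = (\prod_i X i ^ unit_expo i) * ev X (exchange_mpoly S j).
Proof.
rewrite !ev_sum_mon mulr_sumr; apply: eq_bigr => s _.
have gS' : good (mutation k S) by apply: good_mutation.
have [d0 dv] := dg j; have [g gE] := dv k; have sd := leq_ord s.
under [X in _ = _ * X]eq_bigr => i _ do rewrite mnmE -expz_abs ?term_expo_ge0 //.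
rewrite prod_expzD; last exact: X_neq0.
under [LHS]eq_bigr => i _ do rewrite mnmE -expz_abs ?(term_expo_ge0 _ _ (good_deg gS')) //.
rewrite (bigD1 (l k)) //=.
have ekE : term_expo (mutation k S) s (l k) = (d j)%:Z * pos_part g - s%:Z * g.
  rewrite /term_expo /string_expo (unsplitK (inl k)) addr0.
  rewrite [exch_mx _ j _]matrix_mutationN ?eqxx ?orbT // gE -mulrN expo_dvd // opprK; ring.
have -> : Z (l k) ^ term_expo (mutation k S) s (l k)
  = (\prod_i X i ^ (mon_expo i * term_expo (mutation k S) s (l k)))
    * X (l k) ^ (- term_expo (mutation k S) s (l k)).
  set e := term_expo _ _ _; rewrite /Z /setv eqxx.
  have [b0|/eqP b0] := eqVneq beta 0.
    have -> : e = 0 by rewrite /e ekE; rewrite /beta gE in b0; rewrite pos_partE; case: ifP; nia.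
    by rewrite oppr0 !expr0z mulr1 big1 // => i _; rewrite mulr0 expr0z.
  rewrite exchange_at0 // expfzMl exprz_inv; congr (_ * _).
  rewrite (big_morph (fun x : F => x ^ e) (fun x y => expfzMl x y e) (exp1rz _ e)).
  by apply: eq_bigr => i _; rewrite exprz_exp.
have shuffle (a b u v : F) : a * u * b * v = (a * b) * (u * v) by ring.
rewrite (bigD1 (l k)) //= [RHS](bigD1 (l k)) //= shuffle -big_split /=.
congr (_ * _).
  rewrite -!expfzDr ?X_neq0 //; congr (_ ^ _).
  rewrite ekE /mon_expo good_diag // mulr0 [pos_part 0]pos_partE lexx mul0r add0r.
  rewrite /unit_expo eqxx /term_expo /string_expo (unsplitK (inl k)) addr0 gE expo_dvd //.
  rewrite /beta gE normrM ger0_norm; last by lia.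
  have [g0|g0] := leP 0 g; [rewrite ger0_norm //|rewrite ltr0_norm //]; rewrite !pos_partE; do 2?case: ifP; nia.
apply: eq_bigr => i ik.
have -> : Z i ^ term_expo (mutation k S) s i = X i ^ term_expo (mutation k S) s i.
  rewrite /Z /X0 /setv (negPf ik); case: eqP => [->|//].
  by rewrite term_expo_diag // !expr0z.
rewrite -expfzDr ?X_neq0 //; congr (_ ^ _).
rewrite ekE /unit_expo (negPf ik) /term_expo.
have -> : string_expo (mutation k S) s i = string_expo S s i.
  by rewrite /string_expo; case: (split i) => // m /=; rewrite (negPf jk).
rewrite [exch_mx (mutation k S) j i]matrix_mutationE // -/beta -/(mon_expo i).
rewrite {1}/beta gE expo_shift // -gE -/beta.
have -> : pos_part beta = (d j)%:Z * pos_part g.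
  by rewrite /beta gE !pos_partE; do 2?case: ifP; nia.
ring.
Qed.
End Initial.

(** * The exchange step *)

Section ExchangeStep.
Variables (N M : nat) (d : 'I_N -> nat) (S : seed M d) (j k : 'I_N).
Variables (F : fieldType) (X : 'I_(N + M) -> F).
Hypothesis gS : good S.
Hypothesis jk : j != k.
Local Notation l := (lshift M).
Local Notation r := (@rshift N M).
Hypothesis X_inj : forall p, ev X p = 0 -> p = 0.
Variable Ahat : set F.
Hypothesis sA : is_subring Ahat.
Hypothesis A_sub : forall p : {mpoly int[M]}, Ahat (ev (X \o r) p).
Hypothesis A_loc : forall f, Ahat f -> exists p q : {mpoly int[M]},
  [/\ ev (X \o r) q <> 0, Ahat (ev (X \o r) q)^-1 & f = ev (X \o r) p / ev (X \o r) q].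

Let X_neq0 := X_neq0 X_inj.
Let t := X (l j).
Let Y := laurent Ahat (rest X j).
Let sY : is_subring Y := rest_subring j X_inj sA.
Let P := ev X (exchange_mpoly S j).
Let x2 := ev X (exchange_mpoly S k) / X (l k).
Let x1' := ev (setv X (l k) x2) (exchange_mpoly (mutation k S) j) / t.
Let F0 := rees_ring Y t P.
Let L1 := laurent1 Y t.

Let gS' : good (mutation k S) := good_mutation k gS.

Lemma sigma_exchange : ev (setv (@indet (N + M)) (l j) 1) (exchange_mpoly S j) = exchange_mpoly S j.
Proof. by rewrite exchange_mpoly_setv // ev_id. Qed.

Let YP : Y P := P_in_Y X_inj sA A_sub sigma_exchange.

Let P_prim i : ev (setv (@indet (N + M)) i 0) (exchange_mpoly S j) <> 0.
Proof. by have [s hs] := term_mon_prim gS j i; apply: sum_mon_indet0 hs. Qed.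

Let P_neq0 : P != 0.
Proof. by apply/eqP => /X_inj; apply: exchange_mpoly_neq0. Qed.

Let tfree := t_free X_inj sA A_loc (j := j).
Let t_neq0 : t != 0 := X_neq0 (l j).
Let sF0 : is_subring F0 := rees_ring_subring t sY YP.
Let sL1 : is_subring L1 := laurent1_subring t sY.

Let Yx a : a != j -> Y (X (l a)) /\ Y (X (l a))^-1.
Proof.
move=> /negPf aj; have := laurent_var (rest X j) sA a; have := laurent_varV (rest X j) sA a.
by rewrite /rest aj.
Qed.

Let Yst m : Y (X (r m)).
Proof. by apply: laurent_coef => //; have := A_sub 'X_m; rewrite evU. Qed.

Definition polys_over (Q : set F) (p : {poly F}) := forall i : nat, Q p`_i.

Lemma polys_over_closed (Q : set F) n (Z : 'I_n -> {poly F}) : is_subring Q ->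
  (forall i, polys_over Q (Z i)) -> forall p, polys_over Q (ev Z p).
Proof.
move=> sQ QZ; apply: ev_closed => //.
- by move=> i; rewrite coef1; case: eqP => _; [apply: subring1|apply: subring0].
- by move=> p q hp hq i; rewrite coefB; apply: subringB.
- by move=> p q hp hq i; rewrite coefM; apply: subring_sum => // a _; apply: subringM.
Qed.

Lemma polys_overC (Q : set F) c : is_subring Q -> Q c -> polys_over Q c%:P.
Proof. by move=> sQ Qc i; rewrite coefC; case: eqP => _ //; apply: subring0. Qed.

Definition cancellable g := [/\ F0 g, L1 g &
  forall f, L1 f -> F0 (f * g) -> F0 f].

Lemma cancellableM g h : cancellable g -> cancellable h -> cancellable (g * h).
Proof.
move=> [Fg Lg cg] [Fh Lh ch]; split; [exact: subringM|exact: subringM|].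
by move=> f Lf; rewrite mulrA => /ch h'; apply: cg => //; apply: h'; apply: subringM.
Qed.

Lemma cancellable1 : cancellable 1.
Proof. by split; [exact: subring1|exact: subring1|move=> f _; rewrite mulr1]. Qed.

(** The condition of [rees_cancel] on the numerator [q] is automatic in positive
    degrees, as the denominator is at most [t]. *)
Lemma cancellable_of g m (q : {poly F}) u : (m <= 1)%N -> g * t ^+ m = q.[t] ->
  polys_over Y q -> Y u -> q`_0 = u * P ^+ m -> regular_mod Y P u -> cancellable g.
Proof.
move=> m1 gE Yq Yu q0 ru.
have hq : rees Y P m q.
  case=> [|i]; last by rewrite (_ : (m - i.+1)%N = 0%N) ?in_power0 //; lia.
  by rewrite subn0 q0; exists u => //; rewrite mulrC.
split; [by exists m, q|by exists m, q|].
by move=> f Lf; apply: (rees_cancel sY YP P_neq0 t_neq0 tfree Lf gE hq Yu q0 ru).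
Qed.

Let Xt : 'I_(N + M) -> {poly F} := setv (fun i => (X i)%:P) (l j) 'X.

Let Xt_over i : polys_over Y (Xt i).
Proof.
rewrite /Xt /setv; case: eqP => [_|/eqP].
  by move=> a; rewrite coefX; case: eqP => _; [apply: subring1|apply: subring0].
rewrite -{1 2}(splitK i); case: (split i) => a /=.
  by rewrite (inj_eq (@lshift_inj _ _)) => /Yx[Ya _]; apply: polys_overC.
by move=> _; apply: polys_overC.
Qed.

(* the numerators of the k-th and j-th variables of the other seed *)
Let q2 : {poly F} := ev Xt (exchange_mpoly S k) * ((X (l k))^-1)%:P.
Let q1 : {poly F} := ev (setv Xt (l k) q2) (exchange_mpoly (mutation k S) j).

Let q2_over : polys_over Y q2.
Proof.
have kj : k != j by rewrite eq_sym.
move=> i; rewrite coefMC; apply: subringM => //; first exact: polys_over_closed.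
by have [] := Yx kj.
Qed.

Let q1_over : polys_over Y q1.
Proof. by apply: polys_over_closed => // i; rewrite /setv; case: ifP. Qed.

Let horner_Xt (a : F) p : (ev Xt p).[a] = ev (setv X (l j) a) p.
Proof.
rewrite -[LHS]/(horner_eval a (ev Xt p)) rmorph_ev; apply: eq_ev => i /=.
by rewrite /Xt /setv; case: eqP => _; rewrite horner_evalE ?hornerX ?hornerC.
Qed.

Let q2_horner (a : F) : q2.[a] = ev (setv X (l j) a) (exchange_mpoly S k) / X (l k).
Proof. by rewrite /q2 hornerM hornerC horner_Xt. Qed.

Let q1_horner (a : F) : q1.[a] = ev (setv (setv X (l j) a) (l k) q2.[a]) (exchange_mpoly (mutation k S) j).
Proof.
rewrite -[LHS]/(horner_eval a q1) rmorph_ev; apply: eq_ev => i /=.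
rewrite /setv /Xt; case: eqP => _; first by rewrite horner_evalE.
by rewrite /setv; case: eqP => _; rewrite horner_evalE ?hornerX ?hornerC.
Qed.

Let setv_t : setv X (l j) t =1 X.
Proof. by move=> i; rewrite /setv /t; case: eqP => [->|]. Qed.

Let q2_t : q2.[t] = x2.
Proof. by rewrite q2_horner (eq_ev _ setv_t). Qed.

Let q1_t : q1.[t] = x1' * t.
Proof.
rewrite q1_horner q2_t /x1' divfK; last exact: X_neq0.
by apply: eq_ev => i; rewrite {1 3}/setv; case: eqP => // _; apply: setv_t.
Qed.

(** At t = 0, this variable is a monomial if [b_jk <> 0], and the quotient of an
    exchange polynomial coprime to [P] by a unit otherwise. *)
Lemma cancellable_x2 : cancellable x2.
Proof.
have q20 : q2`_0 = ev (setv X (l j) 0) (exchange_mpoly S k) / X (l k).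
  by rewrite -horner_coef0 q2_horner.
have [Yu ru] : Y q2`_0 /\ regular_mod Y P q2`_0.
  split; first exact: q2_over.
  have kj : k != j by rewrite eq_sym.
  have [Yk YkV] := Yx kj.
  rewrite q20; apply: (regularM X_inj sA YkV); last first.
    by apply: (regular_unit X_inj sA); rewrite ?invr_eq0 ?X_neq0 // invrK.
  have [/eqP b0|/eqP b0] := boolP (exch_mx S j (l k) == 0).
    have e0 : exch_mx S k (l j) = 0 by have := @skew_sign _ _ _ S j k gS; rewrite b0; lia.
    have inv (R : comNzRingType) (Z : 'I_(N + M) -> R) a :
        ev (setv Z (l j) a) (exchange_mpoly S k) = ev Z (exchange_mpoly S k).
      rewrite !ev_sum_mon; apply: eq_bigr => s _; apply: eq_bigr => i _.
      rewrite /setv; case: eqP => [->|//].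
      by rewrite mnmE /term_expo /string_expo (unsplitK (inl j)) e0 addr0 expo_zero_row.
    rewrite inv; apply: (regular_of_mpoly X_inj sA A_sub A_loc sigma_exchange).
      by rewrite inv ev_id.
    by move=> c h; apply: exchange_regular.
  rewrite exchange_at0 //.
  have [] := regular_monomial X_inj sA A_sub A_loc sigma_exchange P_prim
    (mon_expo_j gS jk) (fun m => mon_expo_ge0 S j k (r m)).
  by [].
by apply: (@cancellable_of _ 0%N q2 q2`_0); rewrite ?mulr1 ?expr0 ?q2_t.
Qed.

Lemma cancellable_x1' : cancellable x1'.
Proof.
have ge m : 0 <= unit_expo S j k (r m) by apply: unit_expo_ge0.
have [Yu ru] := regular_monomial X_inj sA A_sub A_loc sigma_exchange P_prim
  (unit_expo_j gS jk) ge.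
apply: (@cancellable_of _ 1%N q1 _ _ _ _ Yu _ ru) => //.
rewrite expr1 -horner_coef0 q1_horner q2_horner.
exact: exchange_initial.
Qed.

Lemma cancellable_x a : a != j -> cancellable (X (l a)).
Proof.
move=> aj; have [Ya YaV] := Yx aj.
apply: (@cancellable_of _ 0%N (X (l a))%:P (X (l a))) => //.
- by rewrite mulr1 hornerC.
- exact: polys_overC.
- by rewrite coefC expr0 mulr1.
- by apply: (regular_unit X_inj sA).
Qed.

Lemma rees_in_laurent (x' : 'I_N -> F) : x' j = P / t ->
  (forall a, a != j -> x' a = X (l a)) -> (F0 `<=` laurent Ahat x')%classic.
Proof.
move=> x'j x'a f [m [p [hp fE]]].
have x'0 a : x' a != 0.
  have [->|/x'a ->] := eqVneq a j; last exact: X_neq0.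
  by rewrite x'j mulf_neq0 // invr_neq0 // X_neq0.
have sL := laurent_subring sA x'0.
have YL : (Y `<=` laurent Ahat x')%classic.
  apply: laurent_min => //.
  - by move=> c; apply: laurent_coef.
  - move=> a; rewrite /rest; case: ifP => aj; first exact: subring1.
    by rewrite -x'a ?aj //; apply: laurent_var.
  - move=> a; rewrite /rest; case: ifP => aj; first by rewrite invr1; apply: subring1.
    by rewrite -x'a ?aj //; apply: laurent_varV.
have t0 : t != 0 by exact: X_neq0.
have Lt : laurent Ahat x' t.
  have -> : t = P * (x' j)^-1 by rewrite x'j invf_div mulrC divfK.
  by apply: subringM => //; [apply: YL|apply: laurent_varV].
have -> : f = \sum_(i < size p) p`_i * t ^+ i / t ^+ m.
  by rewrite -mulr_suml -horner_coef -fE mulfK // expf_neq0.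
apply: subring_sum => // i _; have [c Yc ->] := hp i.
have [mi|im] := leqP m i.
  have -> : P ^+ (m - i) * c * t ^+ i / t ^+ m = c * t ^+ (i - m).
    rewrite (_ : (m - i)%N = 0%N) ?mul1r; last by lia.
    by rewrite -{1}(subnK mi) exprD mulrA mulfK // expf_neq0.
  by apply: subringM => //; [apply: YL|apply: subringX].
have -> : P ^+ (m - i) * c * t ^+ i / t ^+ m = c * (x' j) ^+ (m - i).
  rewrite x'j exprMn exprVn -{2}(subnK (ltnW im)) exprD invfM -!mulrA.
  rewrite mulrCA; congr (_ * (_ * _)); rewrite mulrCA mulfV ?mulr1 // expf_neq0 //.
by apply: subringM => //; [apply: YL|apply: subringX => //; apply: laurent_var].
Qed.

(** A monomial in the variables [x''] sends [f] into [F0], and each of these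
    variables can be cancelled. *)
Lemma exchange_step (x' x'' : 'I_N -> F) :
    x' j = P / t -> (forall a, a != j -> x' a = X (l a)) ->
    (forall a, x'' a != 0) -> x'' j = x1' -> x'' k = x2 -> (forall a, a != j -> a != k -> x'' a = X (l a)) ->
  forall f, laurent Ahat (X \o l) f -> laurent Ahat x'' f -> laurent Ahat x' f.
Proof.
move=> x'j x'a x''0 x''j x''k x''a f Lf L''f; apply: (rees_in_laurent x'j x'a).
have cx a : cancellable (x'' a).
  have [->|aj] := eqVneq a j; first by rewrite x''j; apply: cancellable_x1'.
  have [->|ak] := eqVneq a k; first by rewrite x''k; apply: cancellable_x2.
  by rewrite x''a //; apply: cancellable_x.
have AF0 : (Ahat `<=` F0)%classic.
  by move=> c Ac; apply: rees_ringY => //; apply: laurent_coef.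
have [K hK] : exists K, F0 (f * \prod_a x'' a ^+ K).
  by apply: (laurent_clear x''0 sF0 AF0 _ L''f) => a; have [] := cx a.
have L1f : L1 f.
  have YL1 : (Y `<=` L1)%classic.
    move=> c Yc; exists 0%N, c%:P; split; last by rewrite mulr1 hornerC.
    exact: polys_overC.
  apply: (laurent_min sL1 _ _ _ Lf).
  - by move=> c Ac; apply: YL1; apply: laurent_coef.
  - move=> a /=; have [->|/Yx[Ya _]] := eqVneq a j; last exact: YL1.
    exists 0%N, 'X; rewrite mulr1 hornerX; split => // i.
    by rewrite coefX; case: eqP => _; [apply: subring1|apply: subring0].
  - move=> a /=; have [->|/Yx[_ Ya]] := eqVneq a j; last exact: YL1.
    exists 1%N, 1; rewrite hornerC mulVf ?X_neq0 //; split => // i.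
    by rewrite coef1; case: eqP => _; [apply: subring1|apply: subring0].
have [_ _] : cancellable (\prod_a x'' a ^+ K).
  apply: (big_ind cancellable); [exact: cancellable1|exact: cancellableM|].
  move=> a _; elim: K {hK} => [|K IH]; first exact: cancellable1.
  by rewrite exprS; apply: cancellableM.
exact.
Qed.
End ExchangeStep.

(** * Propagation along the tree *)

Section Propagation.
Variables (N : nat) (C : seq 'I_N -> Prop).
Hypothesis C_cancel : forall k w, C (k :: k :: w) <-> C w.
Hypothesis C_cancel2 : forall j k w, C (j :: k :: k :: w) <-> C (j :: w).
Hypothesis C_step : forall j k w, j != k -> C w -> C (j :: k :: w) -> C (j :: w).

(** Stars are the nerves that propagate by themselves along the edges. *)
Definition star u := C u /\ forall k, C (k :: u).

Lemma star_cons k u : star u -> star (k :: u).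
Proof.
move=> [Cu Cs]; split=> // j; have [->|jk] := eqVneq j k; first exact/C_cancel.
by apply: (@C_step j k) => //; apply/C_cancel2.
Qed.

Lemma star_behead k u : star (k :: u) -> star u.
Proof.
move=> [Cu Cs]; have C0 : C u by apply/(C_cancel k).
by split=> // j; have [->//|jk] := eqVneq j k; apply: (@C_step j k).
Qed.

Lemma star_everywhere u : star u -> forall w, C w.
Proof.
move=> su; have s0 : star [::] by elim: u su => // k u IH /star_behead.
by move=> w; suff [] : star w by []; elim: w => // k w; apply: star_cons.
Qed.

Variable W : seq (tree N).
Hypothesis nW : is_nerve W.
Hypothesis CW : forall v, v \in W -> C (val v).

Lemma nerve_root : exists2 v, v \in W & forall w, w \in W -> (size (val v) <= size (val w))%N.
Proof.
have ex : exists n, has (fun v : tree N => size (val v) == n) W.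
  have := nerve_size nW; case: W => // v W' _; exists (size (val v)).
  by rewrite /= eqxx.
case: (ex_minnP ex) => n /hasP[v vW /eqP vn] mn; exists v => // w wW; rewrite vn; apply: mn.
by apply/hasP; exists w.
Qed.

(** In the rooted tree of words, a path from [w] to the root [v] must leave the set of
    words that end with [w], and the only edge out of this set drops the first
    letter of [w]. *)
Lemma nerve_parent v w : v \in W -> (forall u, u \in W -> (size (val v) <= size (val u))%N) ->
  w \in W -> w != v -> exists2 u, u \in W & exists k, val w = k :: val u.
Proof.
move=> vW vmin wW wv; have [p [pp pW lp]] := nerve_connected nW wW vW.
have nlast : ~ exists s, val (last w p) = s ++ val w.
  rewrite lp => -[[|a s] E]; first by case/eqP: wv; apply: val_inj.
  by have := vmin _ wW; rewrite E size_cat /=; lia.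
suff gen q x : x \in W -> path (fun a b => [exists k, edge k a b]) x q ->
    ~ (exists s, val (last x q) = s ++ val w) -> {subset q <= W} ->
    (exists s, val x = s ++ val w) ->
    exists2 u, u \in W & exists k, val w = k :: val u.
  by apply: (gen p w) => //; exists [::].
elim: q x {p pp pW lp nlast} => [|y p IH] x xW /=; first by move=> _ h _ [s E]; case: h; exists s.
move=> /andP[/existsP[k exy] py] nl pW [s E].
have yW : y \in W by apply: pW; rewrite inE eqxx.
have pW' : {subset p <= W} by move=> z zp; apply: pW; rewrite inE zp orbT.
case/orP: exy => /eqP e.
  by apply: (IH y yW py nl pW'); exists (k :: s); exact: etrans e (congr1 (cons k) E).
have {}E := etrans (esym e) E; case: s E => [|a s] /= E'; first by exists y => //; exists k.
by apply: (IH y yW py nl pW'); exists s; case: E'.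
Qed.

(** Sending a vertex other than the root to its first letter is injective, as labels
    are not repeated, hence bijective, by counting.  So the label [b] belongs to an edge
    from [b :: u] to [u]; walking from [u] to the root [v], one meets labels other
    than [b], and the property is transported from [b :: u] to [b :: v]. *)
Lemma nerve_star : exists u, star u.
Proof.
have [v vW vmin] := nerve_root; exists (val v); split; first exact: CW.
have par := nerve_parent vW vmin.
have edgeP k (u w : tree N) : val w = k :: val u -> edge k u w by move=> e; rewrite /edge e eqxx.
move=> b.
have bhead : b \in [seq head b (val w) | w <- W & w != v].
  set s := map _ _.
  have us : uniq s.
    rewrite map_inj_in_uniq ?filter_uniq ?(nerve_uniq nW) //.
    move=> w w'; rewrite !mem_filter => /andP[wv wW] /andP[wv' wW'].
    have [u uW [k E]] := par _ wW wv; have [u' uW' [k' E']] := par _ wW' wv'.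
    rewrite E E' /= => kk; rewrite -kk in E'.
    have [[_ //]|[e e']] := nerve_labels nW uW wW uW' wW' (edgeP _ _ _ E) (edgeP _ _ _ E').
    by move: E E'; rewrite e e' => -> /(congr1 size) /=; lia.
  have ss : size s = N.
    have := nerve_size nW; rewrite size_map size_filter -(count_predC (pred1 v)).
    by rewrite -/(count_mem v W) count_uniq_mem ?(nerve_uniq nW) // vW /= => -[].
  have [||_ ->] := @uniq_min_size _ s (enum 'I_N) us; last by rewrite mem_enum.
    by move=> x _; rewrite mem_enum.
  by rewrite size_enum_ord ss.
have [w wW [u uW E]] : exists2 w, w \in W & exists2 u, u \in W & val w = b :: val u.
  case/mapP: bhead => w; rewrite mem_filter => /andP[wv wW] bE.
  have [u uW [k E]] := par _ wW wv; exists w => //; exists u => //.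
  by rewrite E in bE *; rewrite bE.
have : C (b :: val u) by rewrite -E; apply: CW.
have : (size (val u) < size (val w))%N by rewrite E.
have [n] := ubnP (size (val u)); elim: n (u) (uW) => // n IH x xW xn xw Cx.
have [<-//|xv] := eqVneq x v.
have [y yW [a Ex]] := par _ xW xv; have sx : size (val x) = (size (val y)).+1 by rewrite Ex.
apply: (IH y yW); [by lia|by lia|rewrite Ex in Cx].
apply: (@C_step b a) => //; last exact: CW.
apply/eqP => ba; rewrite -ba in Ex.
have [[_ e]|[e e']] := nerve_labels nW uW wW yW xW (edgeP _ _ _ E) (edgeP _ _ _ Ex).
  by move: xw; rewrite e Ex ba ltnn.
by move: E Ex; rewrite e e' => -> /(congr1 size) /=; lia.
Qed.
End Propagation.

(** * Upper bounds *)

Section Seeds.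
Variables (N M : nat) (d : 'I_N -> nat) (Ahat : set (ratfun N M)).
Hypothesis subring_Ahat : is_subring Ahat.
Hypothesis A_sub_Ahat : (stable_poly_ring N M `<=` Ahat)%classic.
Hypothesis localization_Ahat : is_localization (stable_poly_ring N M) Ahat.
Implicit Types (S : seed M d).

Lemma mutation_step S j k f : good S -> j != k ->
  laurent Ahat (cluster S) f ->
  laurent Ahat (cluster (mutation j (mutation k S))) f ->
  laurent Ahat (cluster (mutation j S)) f.
Proof.
move=> gS jk; have gS' := good_mutation k gS; have gS'' := good_mutation j gS'.
pose X := variables S.
have stE : X \o @rshift N M =1 stable_var N M by move=> m; apply: variables_r.
have evS p : ev (X \o @rshift N M) p = mmap (fun z : int => z%:~R) (stable_var N M) p.
  by rewrite (eq_ev _ stE) evE.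
have -> : cluster S = X \o lshift M.
  by apply: functional_extensionality => a; rewrite /= /X variables_l.
have kj : (j == k) = false by apply/negbTE.
apply: (exchange_step gS jk (good_inj gS) subring_Ahat).
- by move=> p; rewrite evS; apply: A_sub_Ahat; exists p.
- move=> g /localization_Ahat [a [b [[pa _ <-] [pb _ <-] b0 Ab ->]]].
  by exists pa, pb; rewrite !evS; split => //; apply/eqP.
- by rewrite /= eqxx exchange_polyE ?variables_l //; apply: good_deg.
- by move=> a aj; rewrite /= (negPf aj) variables_l.
- by move=> a; rewrite -variables_l; apply: variables_neq0.
- rewrite /= eqxx kj variables_l exchange_polyE; last exact: good_deg.
  rewrite (eq_ev _ (variables_mutation S k)) exchange_polyE ?variables_l //; exact: good_deg.
- by rewrite /= eq_sym kj eqxx exchange_polyE ?variables_l //; apply: good_deg.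
- by move=> a aj ak; rewrite /= (negPf aj) (negPf ak) variables_l.
Qed.

Lemma upper_bound_laurent S W f w : good S -> is_nerve W ->
  upper_bound S Ahat W f -> laurent Ahat (cluster (foldr (@mutation N M d) S w)) f.
Proof.
move=> gS nW Wf; pose C w := laurent Ahat (cluster (foldr (@mutation N M d) S w)) f.
have gw u : good (foldr (@mutation N M d) S u).
  by elim: u => // k u; apply: good_mutation.
have [u su] : exists u, star C u.
  apply: (nerve_star _ nW) => [j k u jk|v vW]; last exact: Wf.
  exact: mutation_step (gw u) jk.
apply: (star_everywhere _ _ _ su w).
- move=> k u'; have e := mutationK k (gw u').
  by rewrite /C -[foldr _ _ [:: k, k & u']]/(mutation k (mutation k (foldr _ S u'))) e.
- move=> j k u'; have e := mutationK k (gw u').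
  by rewrite /C -[foldr _ _ [:: j, k, k & u']]/(mutation j (mutation k (mutation k (foldr _ S u')))) e.
- by move=> j k u' jk; apply: mutation_step (gw u') jk.
Qed.
End Seeds.

Theorem theorem3p11 (N M : nat) (d : 'I_N -> nat) (S : seed M d)
    (seedS : is_seed S)
    (full_rank : int_rank (exch_mx S) = N)
    (string_rank : forall i : 'I_N, d i <> 1%N ->
       int_rank (string_mx S i) = (d i).-1)
    (Ahat : set (ratfun N M))
    (subring_Ahat : is_subring Ahat)
    (A_sub_Ahat : (stable_poly_ring N M `<=` Ahat)%classic)
    (Ahat_sub_Abar : (Ahat `<=` stable_laurent_ring N M)%classic)
    (localization_Ahat : is_localization (stable_poly_ring N M) Ahat) :
  (forall W W' : seq (tree N), is_nerve W -> is_nerve W' ->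
     upper_bound S Ahat W = upper_bound S Ahat W') /\
  (forall W : seq (tree N), is_nerve W ->
     upper_bound S Ahat W = upper_cluster_algebra S Ahat).
Proof.
have gS := seed_good seedS full_rank string_rank.
have main W : is_nerve W -> upper_bound S Ahat W = upper_cluster_algebra S Ahat.
  move=> nW; apply/seteqP; split=> f Wf.
    by move=> _ [w ->]; apply: (upper_bound_laurent _ _ _ _ gS nW Wf).
  by move=> v _; apply: Wf; exists (val v).
by split => // W W' /main -> /main ->.
Qed.
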